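(* The subgroup $T_3=\langle a_{31},a_{22},a_{13},b_{31},b_{22},b_{13}\rangle$ of $VP_4$ is defined, on these six generators, by the relations $$[a_{31},a_{22}^{c_{22}^{m}c_{31}^{-m}}]=[a_{31},a_{13}^{c_{13}^{k}c_{22}^{m-k}c_{31}^{-m}}]=[a_{22}^{c_{22}^{m}c_{31}^{-m}},a_{13}^{c_{13}^{k}c_{22}^{m-k}c_{31}^{-m}}]=1,$$ $$[b_{31},b_{22}^{c_{22}^{m}c_{31}^{-m}}]=[b_{31},b_{13}^{c_{13}^{k}c_{22}^{m-k}c_{31}^{-m}}]=[b_{22}^{c_{22}^{m}c_{31}^{-m}},b_{13}^{c_{13}^{k}c_{22}^{m-k}c_{31}^{-m}}]=1,$$ where $k,m\in\mathbb{Z}$ and $c_{ij}=b_{ij}a_{ij}$.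
   Context: Conventions: $x^{y}=y^{-1}xy$, $[x,y]=x^{-1}y^{-1}xy$. $VP_4$ is the virtual pure braid group on $4$ strands: it has generators $\lambda_{ij}$, $1\le i\ne j\le 4$, and defining relations $\lambda_{ij}\lambda_{kl}=\lambda_{kl}\lambda_{ij}$ and $\lambda_{ki}\lambda_{kj}\lambda_{ij}=\lambda_{ij}\lambda_{kj}\lambda_{ki}$, where distinct letters stand for distinct indices. In $VP_4$ put $a_{31}=\lambda_{14}\lambda_{24}\lambda_{34}$, $a_{22}=\lambda_{14}\lambda_{24}\lambda_{13}\lambda_{23}$, $a_{13}=\lambda_{14}\lambda_{13}\lambda_{12}$, $b_{31}=\lambda_{43}\lambda_{42}\lambda_{41}$, $b_{22}=\lambda_{32}\lambda_{31}\lambda_{42}\lambda_{41}$, $b_{13}=\lambda_{21}\lambda_{31}\lambda_{41}$. *)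

(* Defs.v *)
From HB Require Import structures.
From mathcomp Require Import all_boot all_order all_algebra.
From mathcomp Require Import generic_quotient.
From mathcomp Require Import boolp classical_sets.

Set Implicit Arguments.
Unset Strict Implicit.
Unset Printing Implicit Defensive.

Local Open Scope quotient_scope.
Local Open Scope classical_set_scope.
Local Open Scope group_scope.

Definition expgz (G : groupType) (x : G) (n : int) : G :=
  match n with Posz p => x ^+ p | Negz p => x ^- p.+1 end.

Notation "x ^^ n" := (expgz x n) (at level 29, left associativity) : group_scope.

Definition subgroup_gen (G : groupType) (S : set G) : set G :=
  [set x | forall H : {pred G}, group_closed H ->
     (forall s, S s -> s \in H) -> x \in H].

Definition normal_gen (G : groupType) (S : set G) : set G :=
  [set x | forall H : {pred G}, group_closed H ->
     (forall y z : G, y \in H -> y ^ z \in H) ->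
     (forall s, S s -> s \in H) -> x \in H].

(* A letter (x, false) stands for x and (x, true) for its inverse. *)
Definition word (X : Type) : Type := seq (X * bool).

HB.instance Definition _ (X : Type) := gen_eqMixin (word X).
HB.instance Definition _ (X : Type) := gen_choiceMixin (word X).

Inductive word_eq (X : Type) : word X -> word X -> Prop :=
| word_eq_refl u : word_eq u u
| word_eq_sym u v : word_eq u v -> word_eq v u
| word_eq_trans u v w : word_eq u v -> word_eq v w -> word_eq u w
| word_eq_cancel u v x b : word_eq (u ++ (x, b) :: (x, ~~ b) :: v) (u ++ v).

Section FreeGroup.
Variable X : Type.
Implicit Types u v w : word X.

Let word_eqb : rel (word X) := fun u v => `[< word_eq u v >].

Let word_eqb_refl : reflexive word_eqb.
Proof. by move=> u; apply/asboolP; exact: word_eq_refl. Qed.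
Let word_eqb_sym : symmetric word_eqb.
Proof. by move=> u v; apply/asboolP/asboolP; exact: word_eq_sym. Qed.
Let word_eqb_trans : transitive word_eqb.
Proof.
by move=> v u w /asboolP uv /asboolP vw; apply/asboolP; exact: word_eq_trans vw.
Qed.

Definition word_equiv := EquivRel word_eqb word_eqb_refl word_eqb_sym word_eqb_trans.

Definition free_group : Type := {eq_quot word_equiv}.
HB.instance Definition _ := Choice.on free_group.

Definition free_of_word u : free_group := \pi_({eq_quot word_equiv}) u.

Definition winv u : word X := [seq (l.1, ~~ l.2) | l <- rev u].

Definition free_one : free_group := free_of_word [::].
Definition free_mul (x y : free_group) : free_group :=
  free_of_word (repr (x : {eq_quot word_equiv}) ++ repr (y : {eq_quot word_equiv})).
Definition free_inv (x : free_group) : free_group :=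
  free_of_word (winv (repr (x : {eq_quot word_equiv}))).

Lemma free_of_wordP u v : free_of_word u = free_of_word v <-> word_eq u v.
Proof.
rewrite /free_of_word; split => [/eqmodP/asboolP //|uv].
by apply/eqmodP/asboolP.
Qed.

Lemma free_of_word_surj (x : free_group) : exists u, x = free_of_word u.
Proof.
exists (repr (x : {eq_quot word_equiv})).
by rewrite /free_of_word reprK.
Qed.

Lemma word_eq_repr u :
  word_eq (repr (free_of_word u : {eq_quot word_equiv})) u.
Proof. by apply/free_of_wordP; rewrite /free_of_word reprK. Qed.

Lemma word_eq_catl u v w : word_eq u v -> word_eq (w ++ u) (w ++ v).
Proof.
elim=> {u v} [u|u v _|u v t _ uv _ vt|u v x b].
- exact: word_eq_refl.
- exact: word_eq_sym.
- exact: word_eq_trans vt.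
- by rewrite !catA; exact: word_eq_cancel.
Qed.

Lemma word_eq_catr u v w : word_eq u v -> word_eq (u ++ w) (v ++ w).
Proof.
elim=> {u v} [u|u v _|u v t _ uv _ vt|u v x b].
- exact: word_eq_refl.
- exact: word_eq_sym.
- exact: word_eq_trans vt.
- by rewrite -!catA; exact: word_eq_cancel.
Qed.

Lemma winv_cat u v : winv (u ++ v) = winv v ++ winv u.
Proof. by rewrite /winv rev_cat map_cat. Qed.

Lemma winv_cons l u : winv (l :: u) = winv u ++ [:: (l.1, ~~ l.2)].
Proof. by rewrite /winv rev_cons map_rcons -cats1. Qed.

Lemma winvK u : winv (winv u) = u.
Proof.
elim: u => [|[x b] u IHu] //.
by rewrite winv_cons winv_cat IHu /= negbK.
Qed.

Lemma word_eq_winv u v : word_eq u v -> word_eq (winv u) (winv v).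
Proof.
elim=> {u v} [u|u v _|u v t _ uv _ vt|u v x b].
- exact: word_eq_refl.
- exact: word_eq_sym.
- exact: word_eq_trans vt.
- by rewrite !winv_cat !winv_cons -!catA /= negbK; exact: word_eq_cancel.
Qed.

Lemma word_eq_mulV u : word_eq (u ++ winv u) [::].
Proof.
elim: u => [|[x b] u IHu]; first exact: word_eq_refl.
apply: word_eq_trans (word_eq_cancel [::] [::] x b).
rewrite winv_cons catA.
exact: (word_eq_catl [:: (x, b)] (word_eq_catr [:: (x, ~~ b)] IHu)).
Qed.

Lemma free_mulE u v : free_mul (free_of_word u) (free_of_word v) = free_of_word (u ++ v).
Proof.
apply/free_of_wordP.
apply: word_eq_trans (word_eq_catl _ (word_eq_repr v)).
exact/word_eq_catr/word_eq_repr.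
Qed.

Lemma free_invE u : free_inv (free_of_word u) = free_of_word (winv u).
Proof. by apply/free_of_wordP/word_eq_winv/word_eq_repr. Qed.

Fact free_mulA : associative free_mul.
Proof.
move=> x y z.
have [u ->] := free_of_word_surj x.
have [v ->] := free_of_word_surj y.
have [w ->] := free_of_word_surj z.
by rewrite !free_mulE catA.
Qed.

Fact free_mul1 : left_id free_one free_mul.
Proof. by move=> x; have [u ->] := free_of_word_surj x; rewrite free_mulE. Qed.

Fact free_mulr1 : right_id free_one free_mul.
Proof.
by move=> x; have [u ->] := free_of_word_surj x; rewrite free_mulE cats0.
Qed.

Fact free_mulVx : left_inverse free_one free_inv free_mul.
Proof.
move=> x; have [u ->] := free_of_word_surj x.
rewrite free_invE free_mulE; apply/free_of_wordP.
by rewrite -[X in _ ++ X](winvK u); exact: word_eq_mulV.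
Qed.

Fact free_mulxV : right_inverse free_one free_inv free_mul.
Proof.
move=> x; have [u ->] := free_of_word_surj x.
by rewrite free_invE free_mulE; apply/free_of_wordP; exact: word_eq_mulV.
Qed.

HB.instance Definition _ := isGroup.Build free_group
  free_mulA free_mul1 free_mulr1 free_mulVx free_mulxV.

Definition free_gen (x : X) : free_group := free_of_word [:: (x, false)].

End FreeGroup.

Section NormalGen.
Variables (G : groupType) (S : set G).

Lemma normal_gen1 : normal_gen S 1.
Proof. by move=> H []. Qed.

Lemma normal_genF x y : normal_gen S x -> normal_gen S y -> normal_gen S (x / y).
Proof.
move=> Nx Ny H Hgrp Hconj HS.
by apply: (Hgrp.2); [exact: Nx | exact: Ny].
Qed.

Lemma normal_genV x : normal_gen S x -> normal_gen S x^-1.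
Proof. by rewrite -div1g => Nx; apply: normal_genF Nx; exact: normal_gen1. Qed.

Lemma normal_genM x y : normal_gen S x -> normal_gen S y -> normal_gen S (x * y).
Proof. by move=> Nx Ny; rewrite -[y]invgK; exact/normal_genF/normal_genV. Qed.

Lemma normal_genJ x y : normal_gen S x -> normal_gen S (x ^ y).
Proof. by move=> Nx H Hgrp Hconj HS; apply: (Hconj); exact: Nx. Qed.

End NormalGen.

Section Presented.
Variables (X : Type) (R : set (free_group X)).
Implicit Types x y z : free_group X.

Let pres_eqb : rel (free_group X) := fun x y => `[< normal_gen R (x / y) >].

Let pres_eqb_refl : reflexive pres_eqb.
Proof. by move=> x; apply/asboolP; rewrite mulgV; exact: normal_gen1. Qed.
Let pres_eqb_sym : symmetric pres_eqb.
Proof.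
have sub x y : pres_eqb x y -> pres_eqb y x.
  by move=> /asboolP/normal_genV xy; apply/asboolP; rewrite invgF in xy.
by move=> x y; apply/idP/idP; exact: sub.
Qed.
Let pres_eqb_trans : transitive pres_eqb.
Proof.
move=> y x z /asboolP xy /asboolP yz; apply/asboolP.
by rewrite -(divgKA y); exact: normal_genM.
Qed.

Definition pres_equiv := EquivRel pres_eqb pres_eqb_refl pres_eqb_sym pres_eqb_trans.

(* The quotient of the free group on X by the normal closure of R. *)
Definition presented : Type := {eq_quot pres_equiv}.
HB.instance Definition _ := Choice.on presented.

Definition pres_proj x : presented := \pi_({eq_quot pres_equiv}) x.

Lemma pres_projP x y : pres_proj x = pres_proj y <-> normal_gen R (x / y).
Proof.
rewrite /pres_proj; split => [/eqmodP/asboolP //|xy].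
by apply/eqmodP/asboolP.
Qed.

Definition pres_repr (p : presented) : free_group X :=
  repr (p : {eq_quot pres_equiv}).

Lemma pres_reprK p : pres_proj (pres_repr p) = p.
Proof. by rewrite /pres_proj reprK. Qed.

Definition pres_one : presented := pres_proj 1.
Definition pres_mul (p q : presented) : presented :=
  pres_proj (pres_repr p * pres_repr q).
Definition pres_inv (p : presented) : presented := pres_proj (pres_repr p)^-1.

Lemma pres_mulE x y : pres_mul (pres_proj x) (pres_proj y) = pres_proj (x * y).
Proof.
set x' := pres_repr (pres_proj x); set y' := pres_repr (pres_proj y).
have /pres_projP x'x : pres_proj x' = pres_proj x by exact: pres_reprK.
have /pres_projP y'y : pres_proj y' = pres_proj y by exact: pres_reprK.
apply/pres_projP; rewrite -/x' -/y'.
suff -> : x' * y' / (x * y) = x' / x * (y' / y) ^ x^-1.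
  by apply: normal_genM => //; exact: normal_genJ.
by rewrite /conjg invgK invgM !mulgA mulgVK.
Qed.

Lemma pres_invE x : pres_inv (pres_proj x) = pres_proj x^-1.
Proof.
set x' := pres_repr (pres_proj x).
have /pres_projP x'x : pres_proj x' = pres_proj x by exact: pres_reprK.
apply/pres_projP; rewrite -/x'.
have -> : x'^-1 / x^-1 = (x' / x)^-1 ^ x by rewrite invgF /conjg invgK !mulgA mulVg mul1g.
by apply/normal_genJ/normal_genV.
Qed.

Fact pres_mulA : associative pres_mul.
Proof.
move=> p q r; rewrite -(pres_reprK p) -(pres_reprK q) -(pres_reprK r).
by rewrite !pres_mulE mulgA.
Qed.

Fact pres_mul1 : left_id pres_one pres_mul.
Proof. by move=> p; rewrite -(pres_reprK p) pres_mulE mul1g. Qed.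

Fact pres_mulr1 : right_id pres_one pres_mul.
Proof. by move=> p; rewrite -(pres_reprK p) pres_mulE mulg1. Qed.

Fact pres_mulVx : left_inverse pres_one pres_inv pres_mul.
Proof. by move=> p; rewrite -(pres_reprK p) pres_invE pres_mulE mulVg. Qed.

Fact pres_mulxV : right_inverse pres_one pres_inv pres_mul.
Proof. by move=> p; rewrite -(pres_reprK p) pres_invE pres_mulE mulgV. Qed.

HB.instance Definition _ := isGroup.Build presented
  pres_mulA pres_mul1 pres_mulr1 pres_mulVx pres_mulxV.

Fact pres_projM : {morph pres_proj : x y / x * y}.
Proof. by move=> x y; rewrite -pres_mulE. Qed.

HB.instance Definition _ :=
  isMultiplicative.Build (free_group X) presented pres_proj pres_projM.

Definition pres_gen (x : X) : presented := pres_proj (free_gen x).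

End Presented.

Definition strand_pair (n : nat) : Type := {p : 'I_n * 'I_n | p.1 != p.2}.

(* The generator lambda_ij of the free group; the value 1 when i = j is junk. *)
Definition free_lambda (n : nat) (i j : 'I_n) : free_group (strand_pair n) :=
  oapp (@free_gen (strand_pair n)) 1 (insub (i, j)).

Definition VP_rel (n : nat) : set (free_group (strand_pair n)) :=
  [set r | (exists i j k l : 'I_n, uniq [:: i; j; k; l] /\
             r = (free_lambda i j * free_lambda k l)
                 / (free_lambda k l * free_lambda i j))
        \/ (exists i j k : 'I_n, uniq [:: i; j; k] /\
             r = (free_lambda k i * free_lambda k j * free_lambda i j)
                 / (free_lambda i j * free_lambda k j * free_lambda k i))].

Definition VP (n : nat) : groupType := presented (@VP_rel n).

Definition lambda (n : nat) (i j : 'I_n) : VP n :=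
  pres_proj (@VP_rel n) (free_lambda i j).

(* Strands are numbered 1, ..., 4, whereas 'I_4 starts at 0. *)
Definition lam (i j : nat) : VP 4 := lambda (inord i.-1) (inord j.-1).

Inductive T3_gen := A31 | A22 | A13 | B31 | B22 | B13.

Definition T3_elt (x : T3_gen) : VP 4 :=
  match x with
  | A31 => lam 1 4 * lam 2 4 * lam 3 4
  | A22 => lam 1 4 * lam 2 4 * lam 1 3 * lam 2 3
  | A13 => lam 1 4 * lam 1 3 * lam 1 2
  | B31 => lam 4 3 * lam 4 2 * lam 4 1
  | B22 => lam 3 2 * lam 3 1 * lam 4 2 * lam 4 1
  | B13 => lam 2 1 * lam 3 1 * lam 4 1
  end.

Definition T3 : set (VP 4) := subgroup_gen (range T3_elt).

Definition T3_relators (k m : int) : seq (free_group T3_gen) :=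
  let a31 := free_gen A31 in let a22 := free_gen A22 in let a13 := free_gen A13 in
  let b31 := free_gen B31 in let b22 := free_gen B22 in let b13 := free_gen B13 in
  let c31 := b31 * a31 in let c22 := b22 * a22 in let c13 := b13 * a13 in
  let u := c22 ^^ m * c31 ^^ (- m)%R in
  let v := c13 ^^ k * c22 ^^ (m - k)%R * c31 ^^ (- m)%R in
  [:: [~ a31, a22 ^ u]; [~ a31, a13 ^ v]; [~ a22 ^ u, a13 ^ v];
      [~ b31, b22 ^ u]; [~ b31, b13 ^ v]; [~ b22 ^ u, b13 ^ v]].

Definition T3_rel : set (free_group T3_gen) :=
  [set r | exists k m : int, r \in T3_relators k m].

(* Main.v *)
Require Import Defs.
From HB Require Import structures.
From mathcomp Require Import all_boot all_order all_algebra.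
From mathcomp Require Import boolp classical_sets.

(* Let P be the presented group.  Conjugating (a13, b13) by c13 c22^-1, and
   (a31, b31) by c31 c22^-1, extends to two commuting automorphisms p and w of P.
   Next to the left translations of P they satisfy finitely many relations which
   imply all the relators; in VP_4 the same relations hold for
   p = lambda_21 lambda_12 and w = lambda_43 lambda_34, whence the map P -> VP_4.

   For injectivity, the permutations p a13^-1 a22, b22 b13^-1 p, w a31^-1 a22,
   b22 b31^-1 w of P, together with a13, a31, b13, b31, define an action on P of a
   "cube group" L with eight generators.  VP_4 acts on L x F_6, where F_6 is free on
   lambda_i4, lambda_4i and the first three strands act on F_6 as they do by
   conjugation on the last one; the first components are chosen so that the six
   generators of T3 act on L alone.  The orbit map L -> P, m |-> m . 1, carries that
   action to left multiplication by the generators of P, so an element of P killed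
   in VP_4 is trivial. *)

Set Implicit Arguments.
Unset Strict Implicit.
Unset Printing Implicit Defensive.

Local Open Scope classical_set_scope.
Local Open Scope group_scope.

Section GroupHom.
Variables (G H : groupType) (e : {multiplicative G -> H}).

Lemma hom1 : e 1 = 1.
Proof. by apply: (mulgI (e 1)); rewrite -gmulfM !mulg1. Qed.

Lemma homV : {morph e : x / x^-1}.
Proof. by move=> x; apply: (mulIg (e x)); rewrite -gmulfM !mulVg hom1. Qed.

Lemma homF : {morph e : x y / x / y}.
Proof. by move=> x y; rewrite gmulfM homV. Qed.

Lemma homJ : {morph e : x y / x ^ y}.
Proof. by move=> x y; rewrite !gmulfM homV. Qed.

Lemma homR : {morph e : x y / [~ x, y]}.
Proof. by move=> x y; rewrite !gmulfM !homV. Qed.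

End GroupHom.

Record bij (T : Type) := Bij {
  bij_fun :> T -> T;
  bij_inv : T -> T;
  bij_funK : cancel bij_fun bij_inv;
  bij_invK : cancel bij_inv bij_fun }.

HB.instance Definition _ (T : Type) := gen_eqMixin (bij T).
HB.instance Definition _ (T : Type) := gen_choiceMixin (bij T).

Section BijGroup.
Variable T : Type.
Implicit Types f g h : bij T.

Lemma bijP f g : (forall x, f x = g x) -> f = g.
Proof.
case: f g => [f f' fK f'K] [g g' gK g'K] /= fg.
have {}fg : f = g by apply/funext.
have f'g' : f' = g' by apply/funext => x; rewrite -{1}(g'K x) -fg fK.
case: g / fg in gK g'K *; case: g' / f'g' in gK g'K *.
by congr Bij; exact: Prop_irrelevance.
Qed.

Definition bij_one : bij T := @Bij T id id (fun=> erefl) (fun=> erefl).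
Definition bij_mul f g : bij T :=
  Bij (can_comp (bij_funK f) (bij_funK g)) (can_comp (bij_invK g) (bij_invK f)).
Definition bij_opp f : bij T := Bij (bij_invK f) (bij_funK f).

Fact bij_mulA : associative bij_mul. Proof. by move=> f g h; exact: bijP. Qed.
Fact bij_mul1 : left_id bij_one bij_mul. Proof. by move=> f; exact: bijP. Qed.
Fact bij_mulr1 : right_id bij_one bij_mul. Proof. by move=> f; exact: bijP. Qed.
Fact bij_mulV : left_inverse bij_one bij_opp bij_mul.
Proof. by move=> f; apply: bijP => x; exact: bij_funK. Qed.
Fact bij_mulrV : right_inverse bij_one bij_opp bij_mul.
Proof. by move=> f; apply: bijP => x; exact: bij_invK. Qed.

HB.instance Definition _ := isGroup.Build (bij T)
  bij_mulA bij_mul1 bij_mulr1 bij_mulV bij_mulrV.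

End BijGroup.

Section Translation.
Variable G : groupType.

Definition translation (g : G) : bij G := Bij (mulKg g) (mulVKg g).

Fact translationM : {morph translation : g h / g * h}.
Proof. by move=> g h; apply: bijP => x; rewrite /= mulgA. Qed.

HB.instance Definition _ :=
  isMultiplicative.Build G (bij G) translation translationM.

End Translation.

Lemma free_of_word_cat (X : Type) (u v : word X) :
  free_of_word (u ++ v) = free_of_word u * free_of_word v.
Proof. exact/esym/free_mulE. Qed.

Section Universal.
Variables (X : Type) (G : groupType).

Definition letter_val (h : X -> G) (s : X * bool) : G :=
  if s.2 then (h s.1)^-1 else h s.1.
Definition word_val (h : X -> G) (u : word X) : G :=
  \prod_(s <- u) letter_val h s.

Lemma word_val_eq h u v : word_eq u v -> word_val h u = word_val h v.
Proof.
elim=> {u v} [u|u v _ IH|u v w _ IHu _ IHv|u v s b].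
- by [].
- by [].
- by rewrite IHu.
rewrite /word_val !big_cat !big_cons /letter_val /=; apply: congr1.
by case: b; rewrite mulgA ?mulVg ?mulgV mul1g.
Qed.

Definition free_lift (h : X -> G) (z : free_group X) : G :=
  word_val h (repr (z : {eq_quot (@word_equiv X)}%qT)).

Lemma free_lift_word h u : free_lift h (free_of_word u) = word_val h u.
Proof. exact/word_val_eq/word_eq_repr. Qed.

Fact free_liftM h : {morph free_lift h : y z / y * z}.
Proof.
move=> y z; have [u ->] := free_of_word_surj y.
have [v ->] := free_of_word_surj z.
by rewrite -free_of_word_cat !free_lift_word /word_val big_cat.
Qed.

HB.instance Definition _ h :=
  isMultiplicative.Build (free_group X) G (free_lift h) (free_liftM h).

Lemma free_lift_gen h x : free_lift h (free_gen x) = h x.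
Proof. by rewrite free_lift_word /word_val big_seq1. Qed.

End Universal.

Section Induction.
Variable X : Type.

Lemma free_group_ind (Q : free_group X -> Prop) :
  Q 1 -> (forall x z, Q z -> Q (free_gen x * z)) ->
  (forall x z, Q z -> Q ((free_gen x)^-1 * z)) -> forall z, Q z.
Proof.
move=> Q1 Qg QgV z; have [u ->] := free_of_word_surj z.
elim: u => [//|[x b] u IHu].
rewrite -cat1s free_of_word_cat; case: b; last exact: Qg.
suff -> : free_of_word [:: (x, true)] = (free_gen x)^-1 by exact: QgV.
exact/esym/free_invE.
Qed.

Lemma free_hom_eq (G : groupType) (e e' : {multiplicative free_group X -> G}) :
  (forall x, e (free_gen x) = e' (free_gen x)) -> e =1 e'.
Proof.
move=> ee'; elim/free_group_ind => [|x z IH|x z IH]; first by rewrite !hom1.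
- by rewrite !gmulfM ee' IH.
- by rewrite !gmulfM !homV ee' IH.
Qed.

Lemma free_lift_comp (G H : groupType) (e : {multiplicative G -> H}) (h : X -> G) z :
  e (free_lift h z) = free_lift (fun x => e (h x)) z.
Proof.
move: z; apply: (@free_hom_eq _ (e \o free_lift h) (free_lift (fun x => e (h x)))).
by move=> x /=; rewrite !free_lift_gen.
Qed.

Variable R : set (free_group X).

Lemma presented_ind (Q : presented R -> Prop) :
  Q 1 -> (forall x z, Q z -> Q (pres_gen R x * z)) ->
  (forall x z, Q z -> Q ((pres_gen R x)^-1 * z)) -> forall z, Q z.
Proof.
move=> Q1 Qg QgV z; rewrite -(pres_reprK z).
elim/free_group_ind: (pres_repr z) => [|x y IH|x y IH].
- by rewrite hom1.
- by rewrite gmulfM; exact: Qg.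
- by rewrite gmulfM homV; exact: QgV.
Qed.

Lemma presented_hom_eq (G : groupType) (e e' : {multiplicative presented R -> G}) :
  (forall x, e (pres_gen R x) = e' (pres_gen R x)) -> e =1 e'.
Proof.
move=> ee'; elim/presented_ind => [|x z IH|x z IH]; first by rewrite !hom1.
- by rewrite !gmulfM ee' IH.
- by rewrite !gmulfM !homV ee' IH.
Qed.

Lemma pres_proj_rel z : R z -> pres_proj R z = 1.
Proof.
move=> Rz; rewrite -(hom1 (pres_proj R)); apply/pres_projP.
by rewrite invg1 mulg1 => H _ _; exact.
Qed.

Lemma pres_proj_lift z : pres_proj R z = free_lift (pres_gen R) z.
Proof.
apply: (@free_hom_eq _ (pres_proj R) (free_lift (pres_gen R))) => x /=.
by rewrite free_lift_gen.
Qed.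

Lemma pres_lift_ex (G : groupType) (h : X -> G) :
  (forall z, R z -> free_lift h z = 1) ->
  exists e : {multiplicative presented R -> G}, forall x, e (pres_gen R x) = h x.
Proof.
move=> hR.
have kerN z : normal_gen R z -> free_lift h z = 1.
  move=> Nz; pose K := [pred y | free_lift h y == 1].
  apply/eqP; apply: (Nz K) => [|y t /eqP ey|y Ry]; last by rewrite inE hR.
  - split=> [|y t /eqP ey /eqP et]; first by rewrite inE hom1.
    by rewrite inE homF /= ey et mulgV.
  - by rewrite inE homJ /= ey conj1g.
pose e (u : presented R) := free_lift h (pres_repr u).
have eE z : e (pres_proj R z) = free_lift h z.
  apply: divg1_eq; rewrite -homF; apply: kerN.
  by apply/pres_projP; rewrite pres_reprK.
have eM : {morph e : u v / u * v}.
  move=> u v; rewrite -(pres_reprK u) -(pres_reprK v) -gmulfM !eE.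
  exact: gmulfM.
pose em := isMultiplicative.Build _ _ e eM.
exists (HB.pack e em : {multiplicative presented R -> G}) => x /=.
by rewrite /pres_gen eE free_lift_gen.
Qed.

End Induction.

Section IntPower.
Variable G : groupType.
Implicit Types x y : G.

Lemma expgzS x n : x ^^ (n + 1)%R = x ^^ n * x.
Proof.
case: n => [n|[|n]] /=; first by rewrite addn1 expgSr.
  by rewrite mulVg.
by rewrite subn1 /= [x ^+ n.+2]expgS invgM mulgVK.
Qed.

Lemma expgzB1 x n : x ^^ (n - 1)%R = x ^^ n * x^-1.
Proof. by apply: (mulIg x); rewrite -expgzS GRing.subrK mulgVK. Qed.

Lemma expgzD x m n : x ^^ (m + n)%R = x ^^ m * x ^^ n.
Proof.
elim/int_rect: n => [|n IHn|n IHn]; first by rewrite GRing.addr0 mulg1.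
- by rewrite -addn1 PoszD GRing.addrA !expgzS IHn mulgA.
- by rewrite -addn1 PoszD GRing.opprD GRing.addrA !expgzB1 IHn mulgA.
Qed.

Lemma expgzN x n : x ^^ (- n)%R = (x ^^ n)^-1.
Proof. by apply: (mulIg (x ^^ n)); rewrite -expgzD GRing.addNr mulVg. Qed.

Lemma conj_expgz x y n : (x ^^ n) ^ y = (x ^ y) ^^ n.
Proof. by case: n => n /=; rewrite ?conjVg conjXg. Qed.

End IntPower.

Lemma hom_expgz (G H : groupType) (e : {multiplicative G -> H}) x n :
  e (x ^^ n) = e x ^^ n.
Proof.
elim/int_rect: n => [|n IHn|n IHn]; first exact: hom1.
- by rewrite -addn1 PoszD !expgzS gmulfM IHn.
- by rewrite -addn1 PoszD GRing.opprD !expgzB1 gmulfM homV IHn.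
Qed.

Section Commute.
Variable G : groupType.
Implicit Types x y g : G.

Lemma conjg_id x g : commute x g -> x ^ g = x.
Proof. by rewrite /conjg => ->; rewrite mulKg. Qed.

Lemma conjg_idP x g : x ^ g = x -> commute x g.
Proof. by move=> e; rewrite /commute conjgC e. Qed.

Lemma commuteJ x y g : commute (x ^ g) (y ^ g) <-> commute x y.
Proof.
by rewrite /commute -!conjMg; split=> [/conjg_inj|->].
Qed.

Lemma commg_eq1P x y : [~ x, y] = 1 <-> commute x y.
Proof. by split=> [/eqP/commgP|/commgP/eqP]. Qed.

End Commute.

Ltac commute_tac :=
  solve
    [ assumption
    | apply: commute_sym; assumption
    | exact: commute_refl
    | apply: commuteM; commute_tac
    | apply: commuteV; commute_tac
    | apply: commute_sym; apply: commuteM; commute_tac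
    | apply: commute_sym; apply: commuteV; commute_tac ].

(** * The relators of T3 *)

Section Twist.
Variable G : groupType.
Implicit Types x a y b : G.

Definition twist x a y b (n : int) : G := (y * x) ^^ n * (b * a) ^^ (- n)%R.

Definition T3_commute x a x' y b y' : Prop := forall k m : int,
  [/\ commute (x' ^ twist x' a y' b m) a,
      commute (x' ^ twist x' a y' b m) (x ^ twist x a y b k)
    & commute a (x ^ twist x a y b k)] /\
  [/\ commute (y' ^ twist x' a y' b m) b,
      commute (y' ^ twist x' a y' b m) (y ^ twist x a y b k)
    & commute b (y ^ twist x a y b k)].

Lemma T3_commute_sym x a x' y b y' :
  T3_commute x a x' y b y' -> T3_commute x' a x y' b y.
Proof.
by move=> h k m; have [[? ? ?] [? ? ?]] := h m k; split; split; apply: commute_sym.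
Qed.

(* Conjugating by [c22^m c31^-m] untwists [a22] and makes the two remaining
   twists, along the first and the last strand, independent. *)
Lemma T3_relP (h : T3_gen -> G) :
  (forall r, T3_rel r -> free_lift h r = 1) <->
  T3_commute (h A13) (h A22) (h A31) (h B13) (h B22) (h B31).
Proof.
set x := h A13; set a := h A22; set x' := h A31.
set y := h B13; set b := h B22; set y' := h B31.
have relE k m (u := (twist x' a y' b m)^-1) :
  [seq free_lift h r | r <- T3_relators k m] =
  [:: [~ x' ^ u^-1, a] ^ u; [~ x' ^ u^-1, x ^ twist x a y b k] ^ u;
      [~ a, x ^ twist x a y b k] ^ u;
      [~ y' ^ u^-1, b] ^ u; [~ y' ^ u^-1, y ^ twist x a y b k] ^ u;
      [~ b, y ^ twist x a y b k] ^ u].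
  have uE : u = (b * a) ^^ m * (y' * x') ^^ (- m)%R.
    by rewrite /u /twist invgM !expgzN invgK.
  have vE : (y * x) ^^ k * (b * a) ^^ (m - k)%R * (y' * x') ^^ (- m)%R =
            twist x a y b k * u.
    by rewrite uE [(m - k)%R]GRing.addrC expgzD /twist !mulgA.
  rewrite /T3_relators /= !(homR, homJ, gmulfM, hom_expgz) /= !free_lift_gen.
  rewrite -/x -/a -/x' -/y -/b -/y' vE -uE.
  by rewrite !conjRg !conjgKV -!conjgM.
have J1 (t s : G) : t ^ s = 1 <-> t = 1.
  by split=> [/eqP|->]; rewrite ?conj1g // conjg_eq1 => /eqP.
split=> [rel k m|com r [k [m]]].
  have all1 r : r \in T3_relators k m -> free_lift h r = 1.
    by move=> rin; apply: rel; exists k, m.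
  have {all1} : all (pred1 1) [seq free_lift h r | r <- T3_relators k m].
    by apply/allP => _ /mapP[r /all1 -> ->]; exact: eqxx.
  rewrite relE /= !conjg_eq1 !invgK.
  by case/and5P=> /commgP ? /commgP ? /commgP ? /commgP ? /and3P[/commgP ? /commgP ? _].
move=> /(map_f (free_lift h)); rewrite relE !invgK.
have [[/commg_eq1P -> /commg_eq1P -> /commg_eq1P ->]] := com k m.
move=> [/commg_eq1P -> /commg_eq1P -> /commg_eq1P ->].
by rewrite !conj1g !inE !orbb => /eqP.
Qed.

Section TwistConj.
Variables (x a y b : G).

Lemma twist_twist e k :
  twist (x ^ twist x a y b e) a (y ^ twist x a y b e) b k =
  (twist x a y b e)^-1 * twist x a y b (e + k)%R.
Proof.
rewrite /twist -conjMg -conj_expgz conjgM [X in X ^ _]conjg_id; last first.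
  rewrite /commute -!expgzD; congr (_ ^^ _); exact: GRing.addrC.
by rewrite /conjg !GRing.opprD !expgzD !expgzN !invgM !invgK !mulgA mulgVK.
Qed.

Lemma conj_twist_twist z e k :
  (z ^ twist x a y b e) ^
    twist (x ^ twist x a y b e) a (y ^ twist x a y b e) b k =
  z ^ twist x a y b (e + k)%R.
Proof. by rewrite -conjgM twist_twist mulVKg. Qed.

End TwistConj.

Lemma T3_commute_twist x a x' y b y' e :
  T3_commute x a x' y b y' ->
  T3_commute (x ^ twist x a y b e) a x' (y ^ twist x a y b e) b y'.
Proof. by move=> h k m; rewrite !conj_twist_twist; exact: h. Qed.

End Twist.

Section TwistElement.
Variables (G : groupType) (x a y b p : G).
Hypotheses (xa : commute x a) (yb : commute y b).
Hypotheses (pa : commute p a) (pb : commute p b).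

Lemma twist_conjP :
  (commute y (p * a * x^-1) /\ commute x (b * y^-1 * p)) <->
  (x ^ p = x ^ twist x a y b 1%R /\ y ^ p = y ^ twist x a y b 1%R).
Proof.
have twE : twist x a y b 1%R = y * (x / a) / b.
  by rewrite /twist expgzN invgM !mulgA.
have ypb : (y ^ p) ^ b = y ^ p by rewrite -conjgM pb conjgM (conjg_id yb).
have ypE : commute y (p * a * x^-1) <-> y ^ p = y ^ (x / a).
  split=> [/conjg_id|e].
    by rewrite !conjgM => e; rewrite -[in RHS]e !conjgKV conjgK.
  by apply: conjg_idP; rewrite !conjgM e conjgM conjgKV conjgK.
have ytE : y ^ p = y ^ twist x a y b 1%R <-> y ^ p = y ^ (x / a).
  have -> : y ^ twist x a y b 1%R = (y ^ (x / a)) ^ b^-1.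
    by rewrite twE !conjgM (conjg_id (commute_refl y)).
  split=> [e|<-]; first by rewrite -ypb e conjgKV.
  by rewrite -{2}ypb conjgK.
have xpE : commute x (b * y^-1 * p) <-> x ^ p^-1 = x ^ (b / y).
  split=> [/conjg_id|e].
    by rewrite conjgM => {1}<-; rewrite conjgK.
  by apply: conjg_idP; rewrite conjgM -e conjgKV.
have xtE : y ^ p = y ^ (x / a) ->
    (x ^ p = x ^ twist x a y b 1%R <-> x ^ p^-1 = x ^ (b / y)).
  move=> yp.
  have -> : x ^ twist x a y b 1%R = ((x ^ p^-1) ^ (y / b)) ^ p.
    have xxa : x ^ (x / a) = x by apply: conjg_id; commute_tac.
    rewrite -!conjgM -[RHS]/(x ^ ((y / b) ^ p)) conjMg conjVg.
    rewrite (conjg_id (commute_sym pb)) yp twE -[X in _ = X ^ _]xxa.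
    by rewrite -conjgM !mulgA mulgV mul1g.
  rewrite -[y / b]invgK invgF; split=> [/conjg_inj e|->]; last by rewrite conjgK.
  by rewrite {2}e conjgKV.
split=> [] [h1 h2].
  by have /ypE yp := h1; split; [apply/xtE => //; apply/xpE|apply/ytE].
by have /ytE yp := h2; split; [apply/ypE|apply/xpE/xtE].
Qed.

Hypotheses (xp : x ^ p = x ^ twist x a y b 1%R).
Hypotheses (yp : y ^ p = y ^ twist x a y b 1%R).

Lemma conj_expgz_twist k :
  (x ^ twist x a y b k = x ^ (p ^^ k)) /\ (y ^ twist x a y b k = y ^ (p ^^ k)).
Proof.
have step n z : z ^ p = z ^ twist x a y b 1%R ->
    (z ^ twist x a y b n) ^ p = z ^ twist x a y b (n + 1)%R.
  move=> zp; rewrite conjJg zp.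
  suff -> : twist x a y b n ^ p = twist (x ^ p) a (y ^ p) b n.
    by rewrite xp yp conj_twist_twist GRing.addrC.
  rewrite /twist conjMg !conj_expgz !conjMg.
  by rewrite (conjg_id (commute_sym pb)) (conjg_id (commute_sym pa)).
suff main z : z ^ p = z ^ twist x a y b 1%R -> z ^ twist x a y b k = z ^ (p ^^ k).
  by split; exact: main.
move=> zp; elim/int_rect: k => [|n IHn|n IHn]; first by rewrite /twist mulg1.
- by rewrite -addn1 PoszD -step // IHn -conjgM -expgzS.
- apply: (@conjg_inj _ p); rewrite step // -conjgM -expgzS.
  by rewrite -addn1 PoszD GRing.opprD GRing.subrK.
Qed.

End TwistElement.

Lemma commute_expgz (G : groupType) (u v : G) n : commute u v -> commute u (v ^^ n).
Proof.
by case: n => n uv; [exact: commuteX | exact/commuteV/commuteX].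
Qed.

(* [p] and [w] stand for [lambda_21 lambda_12] and [lambda_43 lambda_34] of VP_4:
   conjugation by them realises the twists, so that finitely many relations
   imply all of those of T3. *)
Definition T3_spine (G : groupType) (x a x' y b y' p w : G) : Prop :=
  [/\ [/\ commute x a, commute x x' & commute a x'],
      [/\ commute y b, commute y y' & commute b y'],
      [/\ commute p a, commute p b, commute p x', commute p y' & commute p w],
      [/\ commute w a, commute w b, commute w x & commute w y] &
      [/\ commute y (p * a * x^-1), commute x (b * y^-1 * p),
          commute y' (w * a * x'^-1) & commute x' (b * y'^-1 * w)]].

Lemma T3_spine_commute (G : groupType) (x a x' y b y' p w : G) :
  T3_spine x a x' y b y' p w -> T3_commute x a x' y b y'.
Proof.
move=> [[xa xx' ax'] [yb yy' by'] [pa pb px' py' pw] [wa wb wx wy] [h1 h2 h3 h4]].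
have [xp yp] := (twist_conjP xa yb pb).1 (conj h1 h2).
have [x'w y'w] := (twist_conjP (commute_sym ax') (commute_sym by') wb).1 (conj h3 h4).
have comm3 z c z' k m : commute z c -> commute z z' -> commute c z' ->
    commute p c -> commute p z' -> commute w c -> commute w z ->
    [/\ commute (z' ^ (w ^^ m)) c, commute (z' ^ (w ^^ m)) (z ^ (p ^^ k))
      & commute c (z ^ (p ^^ k))].
  move=> zc zz' cz' pc pz' wc wz.
  have pow (u v : G) n : commute u v -> v ^ (u ^^ n) = v.
    by move=> uv; apply/conjg_id/commute_expgz/commute_sym.
  split; [rewrite -(pow w c m)//|rewrite -(pow p z' k)//|rewrite -{1}(pow p c k)//].
  - exact/commuteJ/commute_sym.
  - rewrite -conjgM (commute_expgz m (commute_sym (commute_expgz k (commute_sym pw)))).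
    rewrite conjgM; apply/commuteJ; rewrite -(pow w z m)//; exact/commuteJ/commute_sym.
  - exact/commuteJ/commute_sym.
move=> k m; have [-> ->] := conj_expgz_twist pa pb xp yp k.
have [-> ->] := conj_expgz_twist wa wb x'w y'w m.
by split; apply: comm3.
Qed.

(** * Families satisfying the relations of VP_n *)

Definition vp_family (G : groupType) (n : nat) (L : 'I_n -> 'I_n -> G) : Prop :=
  (forall i j k l, uniq [:: i; j; k; l] -> L i j * L k l = L k l * L i j) /\
  (forall i j k, uniq [:: i; j; k] ->
     L k i * L k j * L i j = L i j * L k j * L k i).

Section VPUniversal.
Variable n : nat.

Lemma free_lambda_lift (G : groupType) (L : 'I_n -> 'I_n -> G) i j : i != j ->
  free_lift (fun s : strand_pair n => L (val s).1 (val s).2) (free_lambda i j) = L i j.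
Proof.
by move=> ij; rewrite /free_lambda insubT /= free_lift_gen.
Qed.

Lemma VP_lift_ex (G : groupType) (L : 'I_n -> 'I_n -> G) : vp_family L ->
  exists e : {multiplicative VP n -> G}, forall i j, i != j -> e (lambda i j) = L i j.
Proof.
move=> [Lfar Lyb].
have [|e eE] := @pres_lift_ex _ (@VP_rel n) G (fun s => L (val s).1 (val s).2).
  move=> r [[i [j [k [l [u ->]]]]]|[i [j [k [u ->]]]]]; apply/eqP;
    rewrite homF !gmulfM /= divg_eq1; apply/eqP.
  - have ij : i != j by apply: contraTneq u => ->; rewrite /= !inE eqxx.
    have kl : k != l by apply: contraTneq u => ->; rewrite /= !inE eqxx !andbF.
    by rewrite !free_lambda_lift //; exact: Lfar.
  - have ij : i != j by apply: contraTneq u => ->; rewrite /= !inE eqxx.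
    have ki : k != i by apply: contraTneq u => ->; rewrite /= !inE eqxx orbT.
    have kj : k != j by apply: contraTneq u => ->; rewrite /= !inE eqxx andbF.
    by rewrite !free_lambda_lift //; exact: Lyb.
exists e => i j ij; rewrite /lambda -(free_lambda_lift L ij).
by rewrite /free_lambda insubT /= eE free_lift_gen.
Qed.

Lemma lambda_vp_family : vp_family (@lambda n).
Proof.
have projE x y : VP_rel (x / y) -> pres_proj (@VP_rel n) x = pres_proj (@VP_rel n) y.
  by move=> xy; apply: divg1_eq; rewrite -homF; exact: pres_proj_rel.
split=> [i j k l u|i j k u]; rewrite /lambda.
  by rewrite -[LHS]pres_projM -[RHS]pres_projM; apply: projE; left; exists i, j, k, l.
rewrite -[X in X * _]pres_projM -[X in _ = X * _]pres_projM.
rewrite -[LHS]pres_projM -[RHS]pres_projM.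
by apply: projE; right; exists i, j, k.
Qed.

End VPUniversal.

Section FamilySymmetries.
Variables (G : groupType) (n : nat) (L : 'I_n -> 'I_n -> G).
Hypothesis vpL : vp_family L.

Lemma vp_family_opp : vp_family (fun i j => (L j i)^-1).
Proof.
split=> [i j k l u|i j k u]; rewrite -!invgM.
- by rewrite vpL.1 // -rev_uniq.
- rewrite !mulgA vpL.2 // (perm_uniq (_ : perm_eq _ [:: i; j; k])) //.
  exact: (perm_cat (perm_refl [:: i]) (permEl (perm_catC [:: k] [:: j]))).
Qed.

Lemma vp_family_rev : vp_family (fun i j => L (rev_ord j) (rev_ord i)).
Proof.
have revu s : uniq (map (@rev_ord n) s) = uniq s by exact/map_inj_uniq/rev_ord_inj.
split=> [i j k l u|i j k u].
- rewrite vpL.1 // (perm_uniq (_ : perm_eq _ (map (@rev_ord n) [:: i; j; k; l]))).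
    by rewrite revu.
  apply: (@perm_map _ _ _ [:: j; i; l; k]).
  exact: (perm_cat (permEl (perm_catC [:: j] [:: i])) (permEl (perm_catC [:: l] [:: k]))).
- rewrite -vpL.2 // (perm_uniq (_ : perm_eq _ (map (@rev_ord n) [:: i; j; k]))).
    by rewrite revu.
  apply: (@perm_map _ _ _ [:: i; k; j]).
  exact: (perm_cat (perm_refl [:: i]) (permEl (perm_catC [:: k] [:: j]))).
Qed.

End FamilySymmetries.

Lemma commute_tail (G : groupType) (u v : G) :
  (forall z, u * (v * z) = v * (u * z)) -> commute u v.
Proof. by move=> /(_ 1); rewrite !mulg1. Qed.

Section Cabling.
Variable G : groupType.
Implicit Type L : 'I_4 -> 'I_4 -> G.

Let s1 : 'I_4 := @Ordinal 4 0 isT.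
Let s2 : 'I_4 := @Ordinal 4 1 isT.
Let s3 : 'I_4 := @Ordinal 4 2 isT.
Let s4 : 'I_4 := @Ordinal 4 3 isT.

Definition T3_cable L (g : T3_gen) : G :=
  match g with
  | A31 => L s1 s4 * L s2 s4 * L s3 s4
  | A22 => L s1 s4 * L s2 s4 * L s1 s3 * L s2 s3
  | A13 => L s1 s4 * L s1 s3 * L s1 s2
  | B31 => L s4 s3 * L s4 s2 * L s4 s1
  | B22 => L s3 s2 * L s3 s1 * L s4 s2 * L s4 s1
  | B13 => L s2 s1 * L s3 s1 * L s4 s1
  end.

Definition T3_mirror (g : T3_gen) : T3_gen :=
  match g with
  | A31 => B31 | A22 => B22 | A13 => B13
  | B31 => A31 | B22 => A22 | B13 => A13
  end.

Definition first_loop L : G := L s2 s1 * L s1 s2.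
Definition last_loop L : G := L s4 s3 * L s3 s4.

Section Positive.
Variable L : 'I_4 -> 'I_4 -> G.
Hypothesis vpL : vp_family L.

Let yb i j k : uniq [:: i; j; k] ->
  forall z, L i j * (L i k * (L j k * z)) = L j k * (L i k * (L i j * z)).
Proof.
by move=> u z; rewrite !mulgA vpL.2 // -(rot_uniq 2).
Qed.

Let far i j k l : uniq [:: i; j; k; l] ->
  forall z, L i j * (L k l * z) = L k l * (L i j * z).
Proof. by move=> u z; rewrite !mulgA vpL.1. Qed.

Lemma cable_positive :
  [/\ commute (T3_cable L A13) (T3_cable L A22),
      commute (T3_cable L A13) (T3_cable L A31),
      commute (T3_cable L A22) (T3_cable L A31),
      commute (first_loop L) (T3_cable L A22) &
      commute (first_loop L) (T3_cable L A31)] /\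
  commute (T3_cable L B13) (first_loop L * T3_cable L A22 * (T3_cable L A13)^-1).
Proof.
rewrite /= /first_loop.
split; first (split; apply: commute_tail => z; rewrite -!mulgA).
- by rewrite (@yb s1 s2 s4 isT) (@yb s1 s2 s3 isT) (@far s1 s4 s2 s3 isT) (@far s1 s3 s2 s4 isT).
- rewrite (@yb s1 s2 s4 isT) (@far s1 s2 s3 s4 isT) (@far s1 s3 s2 s4 isT).
  by rewrite (@yb s1 s3 s4 isT).
- rewrite (@far s2 s3 s1 s4 isT) (@yb s2 s3 s4 isT) (@yb s1 s3 s4 isT).
  by rewrite (@far s1 s3 s2 s4 isT).
- rewrite (@yb s1 s2 s4 isT) (@yb s1 s2 s3 isT) (@yb s2 s1 s4 isT).
  by rewrite (@yb s2 s1 s3 isT).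
- rewrite (@yb s1 s2 s4 isT) (@yb s2 s1 s4 isT) (@far s1 s2 s3 s4 isT).
  by rewrite (@far s2 s1 s3 s4 isT).
rewrite -[L s2 s1 * L s3 s1 * _]mulgA -!mulgA.
suff -> : L s2 s1 * (L s1 s2 * (L s1 s4 * (L s2 s4 * (L s1 s3 * (L s2 s3 *
    (L s1 s4 * (L s1 s3 * L s1 s2))^-1))))) = L s2 s1 * (L s2 s4 * L s2 s3).
  apply: commute_tail => z; rewrite -!mulgA -(@yb s2 s4 s1 isT) (@far s3 s1 s2 s4 isT).
  by rewrite (@far s4 s1 s2 s3 isT) -(@yb s2 s3 s1 isT).
rewrite (@yb s1 s2 s4 isT) (@yb s1 s2 s3 isT) (@far s1 s4 s2 s3 isT).
by rewrite !invgM !mulgA !mulgK.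
Qed.

End Positive.

Lemma cable_spine L : vp_family L ->
  T3_spine (T3_cable L A13) (T3_cable L A22) (T3_cable L A31)
    (T3_cable L B13) (T3_cable L B22) (T3_cable L B31)
    (first_loop L) (last_loop L).
Proof.
move=> vpL.
have side13 (K : 'I_4 -> 'I_4 -> G) : vp_family K ->
  [/\ commute (T3_cable K B13) (T3_cable K B22),
      commute (T3_cable K B13) (T3_cable K B31),
      commute (T3_cable K B22) (T3_cable K B31),
      commute (first_loop K) (T3_cable K B22) &
      commute (first_loop K) (T3_cable K B31)] /\
  commute (T3_cable K A13) (T3_cable K B22 * (T3_cable K B13)^-1 * first_loop K).
  move=> vpK; set K' := fun i j => (K j i)^-1.
  have [AB BA] : (forall g, T3_cable K' g = (T3_cable K (T3_mirror g))^-1) /\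
      first_loop K' = (first_loop K)^-1.
    by split=> [[]|]; rewrite /= /first_loop !(invgM, mulgA).
  have comV (u v : G) : commute u^-1 v^-1 -> commute u v.
    by move=> uv; rewrite -[u]invgK -[v]invgK; commute_tac.
  have := cable_positive (vp_family_opp vpK).
  rewrite -/K' !AB BA => -[[/comV c1 /comV c2 /comV c3 /comV c4 /comV c5] c6].
  have invE (u v t : G) : commute u v -> (v * u^-1 * t)^-1 = t^-1 / v / u^-1.
    by move=> uv; rewrite !invgM invgK (commuteV uv) mulgA.
  by split=> //; apply: comV; rewrite (invE _ _ _ c1); exact: c6.
have revE (g : T3_gen) : T3_cable (fun i j => L (rev_ord j) (rev_ord i)) g =
   T3_cable L (match g with A31 => A13 | A13 => A31 | B31 => B13 | B13 => B31 | _ => g end).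
  have r1 : rev_ord s1 = s4 by exact: val_inj.
  have r2 : rev_ord s2 = s3 by exact: val_inj.
  have r3 : rev_ord s3 = s2 by exact: val_inj.
  have r4 : rev_ord s4 = s1 by exact: val_inj.
  case: g; rewrite /= !(r1, r2, r3, r4) //; congr (_ * _); rewrite -!mulgA.
  - by rewrite (vpL.1 s1 s3 s2 s4 isT).
  - by rewrite (vpL.1 s4 s2 s3 s1 isT).
have lE : first_loop (fun i j => L (rev_ord j) (rev_ord i)) = last_loop L.
  by congr (L _ _ * L _ _); exact: val_inj.
have [[xa xx' ax' pa px'] yp] := cable_positive vpL.
have [[yb yy' by' pb py'] xp] := side13 _ vpL.
have [[_ _ _ wa wx] y'w] := cable_positive (vp_family_rev vpL).
have [[_ _ _ wb wy] x'w] := side13 _ (vp_family_rev vpL).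
rewrite !revE !lE in wa wx wb wy y'w x'w.
have pw : commute (first_loop L) (last_loop L).
  have far i j k l : uniq [:: i; j; k; l] -> commute (L i j) (L k l).
    exact: vpL.1.
  rewrite /first_loop /last_loop.
  by apply: commuteM; apply: commute_sym; apply: commuteM; exact: far.
by split.
Qed.

End Cabling.

(** * The cube group and its two loops *)

(* The arguments are the vertices of a cube, adjacent ones commute, and the last
   equation compares the diagonals of the opposite faces x x' j k and y y' l l'. *)
Definition cube (G : groupType) (x y x' y' j k l l' : G) : Prop :=
  [/\ [/\ commute x x', commute x k & commute x l],
      [/\ commute j x', commute j k & commute j y],
      [/\ commute l' x', commute l' y & commute l' l],
      [/\ commute y' y, commute y' k & commute y' l] &
      j * x / (k * x') = y * l / (y' * l')].

Section CubeTheory.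
Variable G : groupType.
Implicit Types x y j k l : G.

Lemma cube_diagonal x y x' y' j k l l' : cube x y x' y' j k l l' ->
  l' * j * x / x' = y / y' * l * k.
Proof.
move=> [[xx' xk xl] [jx' jk jy] [l'x' l'y l'l] [y'y y'k y'l] E].
have kx' : j * x / (k * x') * k = j * x / x'.
  by rewrite invgM !mulgA mulgVK.
have -> : l' * j * x / x' = l' * (j * x / x') by rewrite !mulgA.
rewrite -kx' E invgM !mulgA [l' * y]l'y -[y * l' * l]mulgA l'l mulgA mulgK.
by rewrite -[y * l / y']mulgA (commuteV (commute_sym y'l)) !mulgA.
Qed.

Lemma cube_rot x y x' y' j k l l' :
  cube x y x' y' j k l l' -> cube j l y x l' x' k y'.
Proof.
move=> c; have D := cube_diagonal c.
case: c => [[xx' xk xl] [jx' jk jy] [l'x' l'y l'l] [y'y y'k y'l] E].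
split; try by split; commute_tac.
have yw : commute (l' * j) y^-1 by commute_tac.
have y'w : commute (l * k) y'^-1 by commute_tac.
have xw : commute x x'^-1 by commute_tac.
rewrite !invgM !mulgA yw y'w.
have -> : y^-1 * (l' * j) / x' = y^-1 * (l' * j * x / x') / x.
  by rewrite -[_ * x / x']mulgA xw !mulgA mulgK.
by rewrite D !mulgA mulVg mul1g.
Qed.

Lemma cube_conj x y x' y' j k l l' (s : bool) :
  cube x y x' y' j k l l' ->
  let q := j * x / (k * x') in
  let g := if s then q^-1 else q in
  cube (x ^ g) (y ^ g) x' y' (j ^ g) k (l ^ g) l' /\
  j ^ g * x ^ g / (k * x') = q.
Proof.
move=> [[xx' xk xl] [jx' jk jy] [l'x' l'y l'l] [y'y y'k y'l] E] q g.
pose sg (u : G) := if s then u^-1 else u.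
have conj_g u v (z : G) : q = u / v -> commute u v -> commute z v ->
    z ^ g = z ^ sg u.
  move=> qE uv zv; rewrite /g /sg qE; case: (s); last first.
    by rewrite (commuteV uv) conjgM [z ^ _]conjg_id //; commute_tac.
  by rewrite invgF conjgM [z ^ _]conjg_id.
have uv1 : commute (j * x) (k * x') by commute_tac.
have uv2 : commute (y * l) (y' * l') by commute_tac.
have xg : x ^ g = x ^ sg (j * x) by apply: conj_g => //; commute_tac.
have jg : j ^ g = j ^ sg (j * x) by apply: conj_g => //; commute_tac.
have yg : y ^ g = y ^ sg (y * l) by apply: conj_g E uv2 _; commute_tac.
have lg : l ^ g = l ^ sg (y * l) by apply: conj_g E uv2 _; commute_tac.
have q1 : (j * x) ^ g = j * x by apply: conjg_id; rewrite /g /q; case: (s); commute_tac.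
have q2 : (y * l) ^ g = y * l.
  by apply: conjg_id; rewrite /g /q E; case: (s); commute_tac.
split; last by rewrite -conjMg q1.
have com u v w : commute u w -> commute v w -> commute (u ^ sg v) w.
  by move=> uw vw; rewrite /conjg /sg; case: (s); commute_tac.
split; try split; rewrite -?conjMg ?q1 ?q2 //; try exact/commuteJ.
- by rewrite xg; apply: com; commute_tac.
- by rewrite xg; apply: com; commute_tac.
- by rewrite jg; apply: com; commute_tac.
- by rewrite jg; apply: com; commute_tac.
- by apply: commute_sym; rewrite yg; apply: com; commute_tac.
- by apply: commute_sym; rewrite lg; apply: com; commute_tac.
- by apply: commute_sym; rewrite yg; apply: com; commute_tac.
- by apply: commute_sym; rewrite lg; apply: com; commute_tac.
Qed.

End CubeTheory.

Lemma conj_translation (G : groupType) (e : {multiplicative G -> G}) (F : bij G) :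
  F =1 e -> forall g, translation g ^ F^-1 = translation (e g).
Proof.
move=> Fe g; rewrite /conjg invgK; apply: (mulIg F); rewrite -!mulgA mulVg mulg1.
by apply: bijP => z; rewrite /= !Fe gmulfM.
Qed.

Lemma conj_aut_ex (X : Type) (R : set (free_group X)) (moved : X -> bool)
    (q : presented R)
    (h := fun (s : bool) x => if moved x
       then pres_gen R x ^ (if s then q^-1 else q) else pres_gen R x) :
  (forall s r, R r -> free_lift (h s) r = 1) ->
  (forall s (e : {multiplicative presented R -> presented R}),
     (forall x, e (pres_gen R x) = h s x) -> e q = q) ->
  exists (e : {multiplicative presented R -> presented R}) (F : bij (presented R)),
    F =1 e /\ forall x, e (pres_gen R x) = h false x.
Proof.
move=> hR hq; have [e eE] := pres_lift_ex (hR false).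
have [e' e'E] := pres_lift_ex (hR true).
have eq := hq _ _ eE; have e'q := hq _ _ e'E.
have eK : cancel e e'.
  apply: (@presented_hom_eq _ _ _ (e' \o e) idfun) => x /=; rewrite eE /h.
  case: ifP => mx; last by rewrite e'E /h mx.
  by rewrite homJ e'q e'E /h mx conjgKV.
have e'K : cancel e' e.
  apply: (@presented_hom_eq _ _ _ (e \o e') idfun) => x /=; rewrite e'E /h.
  case: ifP => mx; last by rewrite eE /h mx.
  by rewrite homJ homV eq eE /h mx conjgK.
by exists e, (Bij eK e'K).
Qed.

Inductive cube_gen := CX | CX' | CY | CY' | CJ | CK | CL | CL'.

Definition cube_relators : seq (free_group cube_gen) :=
  let x := free_gen CX in let x' := free_gen CX' in
  let y := free_gen CY in let y' := free_gen CY' in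
  let j := free_gen CJ in let k := free_gen CK in
  let l := free_gen CL in let l' := free_gen CL' in
  [:: [~ x, x']; [~ x, k]; [~ x, l]; [~ j, x']; [~ j, k]; [~ j, y];
      [~ l', x']; [~ l', y]; [~ l', l]; [~ y', y]; [~ y', k]; [~ y', l];
      j * x / (k * x') / (y * l / (y' * l'))].

Definition cube_group := presented [set` cube_relators].

Lemma cube_relP (G : groupType) (h : cube_gen -> G) :
  (forall r, [set` cube_relators] r -> free_lift h r = 1) <->
  cube (h CX) (h CY) (h CX') (h CY') (h CJ) (h CK) (h CL) (h CL').
Proof.
have relE : [seq free_lift h r | r <- cube_relators] =
  [:: [~ h CX, h CX']; [~ h CX, h CK]; [~ h CX, h CL];
      [~ h CJ, h CX']; [~ h CJ, h CK]; [~ h CJ, h CY];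
      [~ h CL', h CX']; [~ h CL', h CY]; [~ h CL', h CL];
      [~ h CY', h CY]; [~ h CY', h CK]; [~ h CY', h CL];
      h CJ * h CX / (h CK * h CX') / (h CY * h CL / (h CY' * h CL'))].
  by rewrite /= !(homR, homF, gmulfM) /= !free_lift_gen.
split=> [rel|[[c1 c2 c3] [c4 c5 c6] [c7 c8 c9] [d1 d2 d3] E] r /= /(map_f (free_lift h))].
  have : all (pred1 1) [seq free_lift h r | r <- cube_relators].
    by apply/allP => _ /mapP[r /rel -> ->]; exact: eqxx.
  rewrite relE /= divg_eq1.
  do 12 (case/andP => /commgP ?); rewrite andbT => /eqP E; by split.
rewrite relE E mulgV !(commg_eq1P _ _).2 //.
by rewrite !inE !orbb => /eqP.
Qed.

Lemma cube_group_cube (c := pres_gen [set` cube_relators]) :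
  cube (c CX) (c CY) (c CX') (c CY') (c CJ) (c CK) (c CL) (c CL').
Proof. by apply/cube_relP => r Rr; rewrite -pres_proj_lift pres_proj_rel. Qed.

Definition cube_loops (G : groupType) (x y x' y' j k l l' p f : G) : Prop :=
  [/\ cube x y x' y' j k l l',
      [/\ commute p x', commute p y', commute p k & commute p l'],
      (let w := p / (j * x / (k * x')) in
       [/\ commute w x, commute w y, commute w j & commute w l]),
      [/\ commute f x, commute f y, commute f x' & commute f y'] &
      (let v := f / (l' * j / (x' * y)) in
       [/\ commute v j, commute v k, commute v l & commute v l'])].

Section CubeAutomorphisms.
Let c := pres_gen [set` cube_relators].

Definition p_moved s := match s with CX | CY | CJ | CL => true | _ => false end.
Definition f_moved s := match s with CJ | CK | CL | CL' => true | _ => false end.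

Lemma cube_p_aut (q := c CJ * c CX / (c CK * c CX')) :
  exists (e : {multiplicative cube_group -> cube_group}) (F : bij cube_group),
    F =1 e /\ forall s, e (c s) = if p_moved s then c s ^ q else c s.
Proof.
apply: (@conj_aut_ex _ _ p_moved q) => [s|s e eE].
  by apply/cube_relP => /=; exact: (cube_conj s cube_group_cube).1.
by rewrite homF !gmulfM !eE /=; exact: (cube_conj s cube_group_cube).2.
Qed.

Lemma cube_f_aut (q := c CL' * c CJ / (c CX' * c CY)) :
  exists (e : {multiplicative cube_group -> cube_group}) (F : bij cube_group),
    F =1 e /\ forall s, e (c s) = if f_moved s then c s ^ q else c s.
Proof.
have rot := cube_rot cube_group_cube.
apply: (@conj_aut_ex _ _ f_moved q) => [s|s e eE].
  apply/cube_relP => /=.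
  exact: cube_rot (cube_rot (cube_rot (cube_conj s rot).1)).
by rewrite homF !gmulfM !eE /=; exact: (cube_conj s rot).2.
Qed.

Lemma cube_loops_ex (t := fun s => translation (c s)) :
  exists (e : {multiplicative cube_group -> cube_group}) (p f : bij cube_group),
    [/\ forall z, (p^-1 : bij _) z = e z,
        forall s, e (c s) = if p_moved s
          then c s ^ (c CJ * c CX / (c CK * c CX')) else c s &
        cube_loops (t CX) (t CY) (t CX') (t CY') (t CJ) (t CK) (t CL) (t CL') p f].
Proof.
have [e [P [Pe eE]]] := cube_p_aut; have [e' [F [Fe' e'E]]] := cube_f_aut.
exists e, P^-1, F^-1; split=> //.
have fixed (T : {multiplicative cube_group -> cube_group}) (K : bij cube_group) s :
    K =1 T -> T (c s) = c s -> commute K^-1 (t s).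
  move=> KT Ts; apply/commute_sym/conjg_idP.
  by rewrite (conj_translation KT) Ts.
have moved (T : {multiplicative cube_group -> cube_group}) (K : bij cube_group) q s :
    K =1 T -> T (c s) = c s ^ q -> commute (K^-1 / translation q) (t s).
  move=> KT Ts; apply/commute_sym/conjg_idP.
  by rewrite conjgM (conj_translation KT) Ts homJ conjgK.
split.
- apply/cube_relP => r Rr.
  rewrite -(free_lift_comp (@translation cube_group)) -pres_proj_lift.
  by rewrite pres_proj_rel // hom1.
- by split; apply: fixed Pe _; rewrite eE.
- have -> : t CJ * t CX / (t CK * t CX') = translation (c CJ * c CX / (c CK * c CX')).
    by rewrite homF !gmulfM.
  by split; apply: moved Pe _; rewrite eE.
- by split; apply: fixed Fe' _; rewrite e'E.
- have -> : t CL' * t CJ / (t CX' * t CY) = translation (c CL' * c CJ / (c CX' * c CY)).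
    by rewrite homF !gmulfM.
  by split; apply: moved Fe' _; rewrite e'E.
Qed.

End CubeAutomorphisms.

(* With s = t, mu = lambda_uv, s (i, false) = lambda_in and s (i, true) = lambda_ni,
   these are the relations of VP_n satisfied by lambda_uv and the last strand n. *)
Definition exchange (G : groupType) (I : Type) (mu : G) (s t : I * bool -> G)
    (u v w : I) : Prop :=
  [/\ mu * (s (u, false) * s (v, false)) = t (v, false) * t (u, false) * mu,
      mu * (s (v, true) * s (u, true)) = t (u, true) * t (v, true) * mu,
      mu * (s (u, false) / s (v, true)) = (t (v, true))^-1 * t (u, false) * mu,
      mu * s (w, false) = t (w, false) * mu & mu * s (w, true) = t (w, true) * mu].

Section LoopIdentities.
Variables (G : groupType) (x y x' y' j k l l' p f a D d m w v : G).
Hypothesis loops : cube_loops x y x' y' j k l l' p f.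
Hypothesis aE0 : a = p^-1 * j * x.
Hypothesis DE0 : D = l' * j * x / x'.
Hypothesis dE0 : d = p^-1 * D.
Hypothesis mE : m = l ^ k.
Hypothesis wE0 : w = p / (j * x / (k * x')).
Hypothesis vE0 : v = f / (l' * j / (x' * y)).

(* The first components of the action of lambda_i4 and lambda_4i on the product of
   the cube group and the free group; the values are forced, given x, x', a, y, y',
   by the products in [strand_loop_cables]. *)
Definition strand_loop (s : 'I_3 * bool) : G :=
  match val s.1, s.2 with
  | 0, false => x * f | 0, true => D^-1 * y
  | 1, false => f^-1 * x^-1 * a | 1, true => m
  | _, false => a^-1 * x' | _, true => k
  end.

Definition strand_loop' (s : 'I_3 * bool) : G :=
  match val s.1, s.2 with
  | 1, false => x^-1 * a * f^-1 | 1, true => l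
  | _, _ => strand_loop s
  end.

Let s1 : 'I_3 := @Ordinal 3 0 isT.
Let s2 : 'I_3 := @Ordinal 3 1 isT.
Let s3 : 'I_3 := @Ordinal 3 2 isT.

Let C : cube x y x' y' j k l l'. Proof. by case: loops. Qed.
Let xx' : commute x x'. Proof. by case: C => [[]]. Qed.
Let xk : commute x k. Proof. by case: C => [[]]. Qed.
Let xl : commute x l. Proof. by case: C => [[]]. Qed.
Let jx' : commute j x'. Proof. by case: C => _ []. Qed.
Let jk : commute j k. Proof. by case: C => _ []. Qed.
Let jy : commute j y. Proof. by case: C => _ []. Qed.
Let l'x' : commute l' x'. Proof. by case: C => _ _ []. Qed.
Let l'y : commute l' y. Proof. by case: C => _ _ []. Qed.
Let l'l : commute l' l. Proof. by case: C => _ _ []. Qed.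
Let y'y : commute y' y. Proof. by case: C => _ _ _ []. Qed.
Let y'k : commute y' k. Proof. by case: C => _ _ _ []. Qed.
Let y'l : commute y' l. Proof. by case: C => _ _ _ []. Qed.
Let px' : commute p x'. Proof. by case: loops => _ []. Qed.
Let py' : commute p y'. Proof. by case: loops => _ []. Qed.
Let pk : commute p k. Proof. by case: loops => _ []. Qed.
Let pl' : commute p l'. Proof. by case: loops => _ []. Qed.
Let fx : commute f x. Proof. by case: loops => _ _ _ []. Qed.
Let fy : commute f y. Proof. by case: loops => _ _ _ []. Qed.
Let fx' : commute f x'. Proof. by case: loops => _ _ _ []. Qed.
Let fy' : commute f y'. Proof. by case: loops => _ _ _ []. Qed.

Let wx : commute w x. Proof. by rewrite wE0; case: loops => _ _ []. Qed.
Let wy : commute w y. Proof. by rewrite wE0; case: loops => _ _ []. Qed.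
Let wj : commute w j. Proof. by rewrite wE0; case: loops => _ _ []. Qed.
Let wl : commute w l. Proof. by rewrite wE0; case: loops => _ _ []. Qed.

Let vj : commute v j. Proof. by rewrite vE0; case: loops => _ _ _ _ []. Qed.
Let vk : commute v k. Proof. by rewrite vE0; case: loops => _ _ _ _ []. Qed.
Let vl : commute v l. Proof. by rewrite vE0; case: loops => _ _ _ _ []. Qed.
Let vl' : commute v l'. Proof. by rewrite vE0; case: loops => _ _ _ _ []. Qed.

Let DE : D = y / y' * l * k. Proof. by rewrite DE0; exact: cube_diagonal C. Qed.

Let pE : p = w * (j * x / (k * x')). Proof. by rewrite wE0 mulgVK. Qed.
Let pE' : p = w * (y * l / (y' * l')).
Proof. by rewrite pE; case: C => _ _ _ _ ->. Qed.

Let pjx : commute p (j * x).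
Proof. by rewrite pE; commute_tac. Qed.
Let pyl : commute p (y * l).
Proof. by rewrite pE'; commute_tac. Qed.

Let divw (s t : G) : commute t s -> t / (p / (s / t)) = s / p.
Proof. by move=> ts; rewrite invgF !mulgA ts mulgK. Qed.

Let aE : a = k * x' / w.
Proof. by rewrite aE0 wE0 divw ?(commuteV (commute_sym pjx)) ?mulgA //; commute_tac. Qed.
Let bE : p^-1 * y * l = y' * l' / w.
Proof.
rewrite wE0; case: C => _ _ _ _ ->.
by rewrite divw ?(commuteV (commute_sym pyl)) ?mulgA //; commute_tac.
Qed.

Let ax : commute a x. Proof. by rewrite aE; commute_tac. Qed.
Let aj : commute a j. Proof. by rewrite aE; commute_tac. Qed.
Let ax' : commute a x'. Proof. by rewrite aE0; commute_tac. Qed.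
Let ak : commute a k. Proof. by rewrite aE0; commute_tac. Qed.
Let pa : commute p a.
Proof. by rewrite aE0 -mulgA; commute_tac. Qed.
Let bl : commute (p^-1 * y * l) l. Proof. by rewrite bE; commute_tac. Qed.
Let pD : commute p D.
Proof. by rewrite DE0 -[l' * j * x]mulgA; commute_tac. Qed.

Let vE : f = v * (l' * j / (x' * y)). Proof. by rewrite vE0 mulgVK. Qed.
Let vE' : f = v * (l * k / (x * y')).
Proof. by rewrite vE; case: (cube_rot C) => _ _ _ _ ->. Qed.
Let fl'j : commute f (l' * j). Proof. by rewrite vE; commute_tac. Qed.
Let flk : commute f (l * k). Proof. by rewrite vE'; commute_tac. Qed.
Let fD : commute f D.
Proof. by rewrite DE0; commute_tac. Qed.

Let fk_l : commute (f / k) l.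
Proof.
rewrite vE'.
have -> : v * (l * k / (x * y')) / k = v * (l / (x * y')).
  have e : commute k (x * y') by commute_tac.
  by rewrite -!mulgA [_ * (_^-1 * _^-1)]mulgA (commuteV e) mulgK.
by commute_tac.
Qed.
Let flk_k : commute (f / (l * k)) k.
Proof.
have e : commute (l * k) (x * y')^-1 by commute_tac.
by rewrite vE' e [v * _]mulgA mulgK; commute_tac.
Qed.
Let fl'j_j : commute (f / (l' * j)) j.
Proof.
have e : commute (l' * j) (x' * y)^-1 by commute_tac.
by rewrite vE e [v * _]mulgA mulgK; commute_tac.
Qed.
Let fj_l' : commute (f / j) l'.
Proof.
rewrite vE.
have -> : v * (l' * j / (x' * y)) / j = v * (l' / (x' * y)).
  have e : commute j (x' * y) by commute_tac.
  by rewrite -!mulgA [_ * (_^-1 * _^-1)]mulgA (commuteV e) mulgK.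
by commute_tac.
Qed.

Let x1x2 : x * f * (f^-1 * x^-1 * a) = a.
Proof. by rewrite !mulgA mulgK mulgV mul1g. Qed.
Let X2x1 : x^-1 * a * f^-1 * (x * f) = a.
Proof. by rewrite -fx mulgA mulgVK -mulgA ax mulKg. Qed.

Let l_k : k * m = l * k.
Proof. by rewrite mE -conjgC. Qed.
Let f_lk : f * m = l * f.
Proof.
have -> : f * m = f / k * (k * m) by rewrite [RHS]mulgA mulgVK.
by rewrite l_k [LHS]mulgA fk_l -[LHS]mulgA mulgVK.
Qed.
Let D1y : D^-1 * y = (l * k)^-1 * y'.
Proof.
apply: (mulgI D); rewrite mulVKg DE -[_ * l * k]mulgA -mulgA mulVKg.
by rewrite mulgVK.
Qed.
Let y2y1 : m * (D^-1 * y) = D^-1 * y * l.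
Proof.
rewrite D1y -[RHS]mulgA y'l invgM mE /conjg -!mulgA mulVKg mulVKg !mulgA.
by rewrite mulgVK.
Qed.

Let f_lkV : f / m = l^-1 * f.
Proof. by apply: (mulIg (m)); rewrite mulgVK -[RHS]mulgA f_lk mulKg. Qed.
Let pxa : p * x^-1 * a = j.
Proof.
by rewrite -mulgA (commute_sym (commuteV ax)) mulgA aE0 -!mulgA mulVKg mulgV mulg1.
Qed.
Let ap : a * p = j * x.
Proof. by rewrite -pa aE0 -mulgA mulVKg. Qed.
Let Dfx_j : commute (D / f / x) j.
Proof.
have -> : D / f / x = (f / (l' * j))^-1 / x'.
  have cx : commute x (x'^-1 * f^-1) by commute_tac.
  have cf : commute x'^-1 f^-1 by commute_tac.
  rewrite invgF DE0 -!mulgA; do 2 congr (_ * _).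
  by rewrite [x'^-1 * _]mulgA mulgA cx mulgK.
by commute_tac.
Qed.

Let xp_j : commute (x / p) j.
Proof.
have -> : x / p = j^-1 * a.
  by apply: (mulgI j); rewrite mulVKg mulgA -ap mulgK.
by commute_tac.
Qed.
Let py_l : commute (p^-1 * y) l.
Proof. by rewrite -[p^-1 * y](mulgK l); commute_tac. Qed.
Let dE : d = l' / x' * a.
Proof.
have c1 : commute p^-1 l' by commute_tac.
have c2 : commute (p^-1 * j * x) x'^-1 by commute_tac.
by rewrite dE0 DE0 aE0 -[RHS]mulgA -c2 !mulgA c1.
Qed.
Let dx3 : d * (a^-1 * x') = l'.
Proof. by rewrite dE !mulgA mulgK mulgVK. Qed.
Let x3d : a^-1 * x' * d = l' ^ (j * x).
Proof.
have la : l' * a = a * l' ^ (j * x).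
  rewrite [LHS]conjgC; congr (_ * _); rewrite aE0 -mulgA (conjgM l' p^-1) [l' ^ p^-1]conjg_id //.
  by commute_tac.
have -> : a^-1 * x' * d = a^-1 * (x' * l' / x' * a) by rewrite dE !mulgA.
by rewrite -l'x' mulgK la mulKg.
Qed.
Let x1_l' : x * f * l' ^ (j * x) = l' * x * f.
Proof.
rewrite -fx /conjg invgM !mulgA mulgK fj_l' [l' * _]mulgA mulgVK.
by rewrite -mulgA fx mulgA.
Qed.
Let y_p : y ^ p = y ^ l.
Proof.
have c : commute (y * l) (y' * l')^-1 by commute_tac.
rewrite pE' c !conjgM (conjg_id (commute_sym wy)) [y ^ (_^-1)]conjg_id; last by commute_tac.
by rewrite (conjg_id (commute_refl y)).
Qed.
Let y_D : y ^ D = (y ^ l) ^ k.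
Proof.
rewrite DE !conjgM (conjg_id (commute_refl y)) [y ^ (_^-1)]conjg_id //.
by commute_tac.
Qed.
Let l'_D : l' ^ D = l' ^ (j * x).
Proof.
rewrite DE0 -[l' * j * x]mulgA (conjgM l' (_ * _)) (conjgM l' l') (conjg_id (commute_refl l')).
rewrite [_ ^ x'^-1]conjg_id // /conjg; commute_tac.
Qed.

Lemma exchange12 : exchange 1 strand_loop strand_loop' s1 s2 s3.
Proof.
split; rewrite /strand_loop' /strand_loop /=; rewrite ?mul1g ?mulg1 ?x1x2 ?X2x1 //.
by rewrite -mulgA f_lkV !mulgA (commuteV xl).
Qed.

Lemma exchange21 : exchange p strand_loop' strand_loop s2 s1 s3.
Proof.
split; rewrite /strand_loop' /strand_loop /=.
- by rewrite X2x1 x1x2.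
- rewrite y2y1; suff : commute p (D^-1 * y * l) by [].
  by rewrite -mulgA; commute_tac.
- rewrite invgM invgK !mulgA pxa -[RHS]mulgA ap.
  have -> : y^-1 * D / f / x * (j * x) = y^-1 * (D / f / x * j) * x.
    by rewrite !mulgA.
  rewrite Dfx_j !mulgA mulgVK -(commuteV jy).
  have fyD : commute f^-1 (y^-1 * D) by commute_tac.
  by rewrite -!mulgA fyD !mulgA.
- suff : commute p (a^-1 * x') by [].
  by commute_tac.
- exact: pk.
Qed.

Lemma exchange13 : exchange f^-1 strand_loop' strand_loop s1 s3 s2.
Proof.
split; rewrite /strand_loop' /strand_loop /=.
- have c : commute x (a^-1 * x') by commute_tac.
  by rewrite -fx -[f * x * _]mulgA mulKg c fx [_ * (x * f)]mulgA mulgK.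
- have ck : commute (D^-1 * y * f) k.
    have cf : commute f (l * k)^-1 by commute_tac.
    by rewrite D1y -mulgA -fy' mulgA -cf; commute_tac.
  have cf : commute f (D^-1 * y) by commute_tac.
  apply: (mulgI f); rewrite mulVKg; apply: (mulIg f).
  by rewrite -[LHS]mulgA -ck -cf -[LHS]mulgA !mulgA mulgVK.
- by rewrite -{1}fx -[f * x * _]mulgA mulKg mulgA mulgK (commuteV xk).
- by rewrite !mulgA.
- by apply: (mulgI f); rewrite mulVKg mulgA f_lk mulgK.
Qed.

Lemma exchange31 : exchange d strand_loop strand_loop' s3 s1 s2.
Proof.
split; rewrite /strand_loop' /strand_loop /=.
- by rewrite mulgA dx3 -[RHS]mulgA x3d x1_l' mulgA.
- transitivity (y ^ l * k * p^-1).
    have py : p^-1 * y = y ^ l * p^-1 by rewrite -y_p /conjg !mulgA mulgK.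
    by rewrite dE0 !mulgA mulgK py -mulgA -(commuteV (commute_sym pk)) mulgA.
  rewrite dE0 -(commuteV (commute_sym pD)) !mulgA -[k * _ * _]mulgA -[k * _ * _]mulgA.
  have -> : D^-1 * y * D = y ^ D by rewrite /conjg mulgA.
  by rewrite y_D -conjgC.
- rewrite mulgA dx3 -[RHS]mulgA x3d invgM invgK -l'_D mulgA (commuteV l'y).
  by rewrite -!mulgA -conjgC.
- have xa : x^-1 * a = p^-1 * j by apply: (mulgI p); rewrite mulVKg mulgA.
  have c : commute (D / f / p) j.
    have -> : D / f / p = D / f / x * (x / p) by rewrite !mulgA mulgVK.
    by commute_tac.
  have cp : commute p^-1 D by commute_tac.
  have cf : commute f^-1 D by commute_tac.
  rewrite -[f^-1 * _ * _]mulgA xa dE0; transitivity (p^-1 * (D / f / p * j)).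
    by rewrite !mulgA.
  by rewrite c cp !mulgA -[_ * f^-1 * D]mulgA cf !mulgA.
- rewrite dE0 DE !mulgA -[LHS]mulgA l_k; suff : commute (p^-1 * y / y' * l) l.
    by move=> c; rewrite mulgA c !mulgA.
  by commute_tac.
Qed.

Lemma exchange23 : exchange f strand_loop strand_loop' s2 s3 s1.
Proof.
split; rewrite /strand_loop' /strand_loop /=.
- have c : commute a (x' / x) by commute_tac.
  rewrite !mulgA mulgV mul1g mulgK mulgVK -[a^-1 * x' / x]mulgA -[RHS]mulgA -c.
  by rewrite mulKg (commuteV (commute_sym xx')).
- by rewrite l_k flk.
- have c : commute k^-1 (x^-1 * a) by commute_tac.
  by rewrite !mulgA mulgV mul1g mulgVK -[RHS]mulgA c.
- by rewrite mulgA fx.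
- suff : commute f (D^-1 * y) by [].
  by commute_tac.
Qed.

Lemma exchange32 : exchange 1 strand_loop' strand_loop s3 s2 s1.
Proof.
have k_w : a^-1 * x' = k^-1 * w.
  apply: (mulgI a); rewrite mulVKg mulgA (commuteV ak) -mulgA {1}aE.
  by rewrite mulgVK mulKg.
split; rewrite /strand_loop' /strand_loop /=; rewrite mul1g mulg1 //.
- have c : commute a (x' / x) by commute_tac.
  have cf : commute f (x' / x) by commute_tac.
  rewrite !mulgA mulgK -[a^-1 * x' / x]mulgA -[a^-1 * _ * a]mulgA -c mulKg.
  by rewrite (commuteV (commute_sym cf)) (commuteV (commute_sym xx')) mulgA.
- by rewrite k_w mE -conjVg /conjg !mulgA mulgK -!mulgA (commuteV wl).
Qed.

Lemma strand_loop_cables :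
  [/\ strand_loop (s1, false) * strand_loop (s2, false) * strand_loop (s3, false) = x',
      strand_loop (s1, false) * strand_loop (s2, false) = a &
      strand_loop (s1, false) * f^-1 = x] /\
  [/\ strand_loop (s3, true) * strand_loop (s2, true) * strand_loop (s1, true) = y',
      d * strand_loop (s2, true) * strand_loop (s1, true) = p^-1 * y * l &
      p * d * strand_loop (s1, true) = y].
Proof.
split; split; rewrite /strand_loop /=.
- by rewrite x1x2 mulVKg.
- exact: x1x2.
- exact: mulgK.
- by rewrite l_k D1y mulVKg.
- by rewrite -mulgA y2y1 dE0 !mulgA mulgK.
- by rewrite dE0 mulVKg mulVKg.
Qed.

Lemma diagonal_loop_commute : commute p D /\ commute f D.
Proof. by []. Qed.

End LoopIdentities.

(** * The action on the free group of the last strand *)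

Section FreeAction.
Variable I : eqType.
Implicit Types i j k : I.
Notation F := (free_group (I * bool)).
Let X i : F := free_gen (i, false).
Let Y i : F := free_gen (i, true).

Definition strand_image i j (s : I * bool) : F :=
  if s.2 then
    if s.1 == j then Y j ^ X i
    else if s.1 == i then (Y j ^ X i)^-1 * Y i * Y j else Y s.1
  else if s.1 == j then X j ^ X i else X s.1.

Definition strand_preimage i j (s : I * bool) : F :=
  if s.2 then
    if s.1 == j then Y j ^ (X i)^-1
    else if s.1 == i then Y j * Y i / (Y j ^ (X i)^-1) else Y s.1
  else if s.1 == j then X j ^ (X i)^-1 else X s.1.

Let imageX i j : free_lift (strand_image i j) (X i) = X i.
Proof.
rewrite free_lift_gen /strand_image /=; case: eqP => [->|//].
exact/conjg_id/commute_refl.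
Qed.

Let preimageX i j : free_lift (strand_preimage i j) (X i) = X i.
Proof.
rewrite free_lift_gen /strand_preimage /=; case: eqP => [->|//].
exact/conjg_id/commuteV/commute_refl.
Qed.

Fact strand_imageK i j :
  cancel (free_lift (strand_image i j)) (free_lift (strand_preimage i j)).
Proof.
apply: (@free_hom_eq _ _ (free_lift (strand_preimage i j) \o free_lift (strand_image i j)) idfun).
move=> [k []] /=; rewrite free_lift_gen /strand_image /=.
  case: eqP => [->|/eqP kj].
    rewrite homJ /= preimageX free_lift_gen /strand_preimage /= eqxx.
    by rewrite conjgKV.
  case: eqP => [ki|/eqP ki]; last first.
    by rewrite free_lift_gen /strand_preimage /= (negPf kj) (negPf ki).
  rewrite !gmulfM homV homJ /= preimageX !free_lift_gen /strand_preimage /= eqxx.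
  rewrite -ki (negPf kj) eqxx !ki conjgKV.
  by move: (_ ^ _) => t; rewrite -[Y j * _ / _]mulgA mulKg mulgVK.
case: eqP => [->|/eqP kj].
  by rewrite homJ /= preimageX free_lift_gen /strand_preimage /= eqxx conjgKV.
by rewrite free_lift_gen /strand_preimage /= (negPf kj).
Qed.

Fact strand_preimageK i j :
  cancel (free_lift (strand_preimage i j)) (free_lift (strand_image i j)).
Proof.
apply: (@free_hom_eq _ _ (free_lift (strand_image i j) \o free_lift (strand_preimage i j)) idfun).
move=> [k []] /=; rewrite free_lift_gen /strand_preimage /=.
  case: eqP => [->|/eqP kj].
    by rewrite homJ homV /= imageX free_lift_gen /strand_image /= eqxx conjgK.
  case: eqP => [ki|/eqP ki]; last first.
    by rewrite free_lift_gen /strand_image /= (negPf kj) (negPf ki).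
  rewrite !gmulfM homV homJ homV /= imageX !free_lift_gen /strand_image /= eqxx.
  rewrite -ki (negPf kj) eqxx !ki conjgK.
  by move: (Y j ^ X i) => t; rewrite -!mulgA mulVKg mulgV mulg1.
case: eqP => [->|/eqP kj].
  by rewrite homJ homV /= imageX free_lift_gen /strand_image /= eqxx conjgK.
by rewrite free_lift_gen /strand_image /= (negPf kj).
Qed.

Definition strand_bij i j : bij F := Bij (@strand_imageK i j) (@strand_preimageK i j).

Let bijM i j : {morph strand_bij i j : u v / u * v}.
Proof. exact: free_liftM. Qed.
Let bijV i j : {morph strand_bij i j : u / u^-1}.
Proof. exact: homV. Qed.
Let bijJ i j : {morph strand_bij i j : u v / u ^ v}.
Proof. exact: homJ. Qed.

Lemma strand_bijX i j k :
  strand_bij i j (X k) = if k == j then X j ^ X i else X k.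
Proof. exact: free_lift_gen. Qed.

Lemma strand_bijY i j k :
  strand_bij i j (Y k) = if k == j then Y j ^ X i
    else if k == i then (Y j ^ X i)^-1 * Y i * Y j else Y k.
Proof. exact: free_lift_gen. Qed.

Lemma strand_bij_yb i j k : uniq [:: i; j; k] ->
  strand_bij k i * strand_bij k j * strand_bij i j =
  strand_bij i j * strand_bij k j * strand_bij k i.
Proof.
rewrite /= !inE negb_or andbT => /andP[/andP[ij ik] jk].
have [ji ki kj] : [/\ j != i, k != i & k != j] by split; rewrite eq_sym.
pose e a b := free_lift (strand_image a b).
pose sX := strand_bijX; pose sY := strand_bijY.
pose ne := (eqxx, negPf ij, negPf ik, negPf jk, negPf ji, negPf ki, negPf kj).
apply: bijP.
apply: (@free_hom_eq _ _ (e k i \o (e k j \o e i j)) (e i j \o (e k j \o e k i))).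
pose r := strand_bij; move=> [m []].
  suff : r k i (r k j (r i j (Y m))) = r i j (r k j (r k i (Y m))) by [].
  have [->|mi] := eqVneq m i.
    rewrite /r !(strand_bijX, strand_bijY, bijM, bijJ, bijV, ne).
    by rewrite -conjJg -conjVg -!conjMg.
  have [->|mj] := eqVneq m j.
    rewrite /r !(strand_bijX, strand_bijY, bijM, bijJ, bijV, ne).
    by rewrite -conjJg.
  have [->|mk] := eqVneq m k.
    rewrite /r !(strand_bijX, strand_bijY, bijM, bijJ, bijV, ne).
    move: (Y j ^ X i) => z; rewrite 2!conjMg conjVg.
    by move: (Y j ^ X k) (Y i ^ X k) (z ^ X k) => s t u; rewrite !gnorm.
  by rewrite /r !(strand_bijY, negPf mi, negPf mj, negPf mk).
suff : r k i (r k j (r i j (X m))) = r i j (r k j (r k i (X m))) by [].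
have [->|mi] := eqVneq m i.
  by rewrite /r !(strand_bijX, bijJ, ne).
have [->|mj] := eqVneq m j.
  rewrite /r !(strand_bijX, strand_bijY, bijM, bijJ, bijV, ne).
    by rewrite -conjJg.
by rewrite /r !(strand_bijX, negPf mi, negPf mj).
Qed.

Lemma strand_bij_exchange i j k (r := strand_bij i j) : i != j -> k != i -> k != j ->
  [/\ r (X i * X j) = X j * X i, r (Y j * Y i) = Y i * Y j,
      r (X i / Y j) = (Y j)^-1 * X i, r (X k) = X k & r (Y k) = Y k].
Proof.
move=> ij ki kj; have ji : j != i by rewrite eq_sym.
pose ne := (eqxx, negPf ij, negPf ji, negPf ki, negPf kj).
rewrite /r !(bijM, bijV) !(strand_bijX, strand_bijY, ne).
split=> //.
- by rewrite -conjgC.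
- by rewrite mulgA mulVKg.
- by rewrite /conjg !invgM invgK !mulgA mulgV mul1g.
Qed.

End FreeAction.

(** * Extension of a VP_3 action to VP_4 *)

Section Extension.
Variables (G : groupType) (M : 'I_3 -> 'I_3 -> G) (T : 'I_3 * bool -> G).
Hypothesis vpM : vp_family M.
Hypothesis exM : forall i j k, uniq [:: i; j; k] -> exchange (M i j) T T i j k.

Definition add_strand (i j : 'I_4) : G :=
  match unlift ord_max i, unlift ord_max j with
  | Some i', Some j' => M i' j'
  | Some i', None => T (i', false)
  | None, Some j' => T (j', true)
  | None, None => 1
  end.

Let third (i j : 'I_3) : i != j -> exists k, uniq [:: i; j; k].
Proof.
move=> ij; have /subsetPn[k _ kij] : ~~ ('I_3 \subset [:: i; j]).
  apply/negP => /subset_leq_card; rewrite card_ord leqNgt.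
  by rewrite (leq_ltn_trans (card_size _)).
exists k; move: kij; rewrite /= !inE !negb_or => /andP[ki kj].
by rewrite ij ![_ == k]eq_sym ki kj.
Qed.

Let uniq3P (i j k : 'I_3) : uniq [:: i; j; k] = [&& i != j, i != k & j != k].
Proof. by rewrite /= !inE negb_or andbT andbA. Qed.

Lemma add_strand_vp_family : vp_family add_strand.
Proof.
have lf (i : 'I_3) : (lift ord_max i == ord_max :> 'I_4) = false.
  by rewrite eq_sym (negPf (neq_lift _ _)).
have fl (i : 'I_3) : (ord_max == lift ord_max i :> 'I_4) = false.
  by rewrite (negPf (neq_lift _ _)).
have fixT a b c s : [&& a != b, a != c & b != c] -> M a b * T (c, s) = T (c, s) * M a b.
  by rewrite -uniq3P => /exM[_ _ _]; case: s.
split=> [i j k l|i j k].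
  rewrite /add_strand.
  have [i'|] := unliftP ord_max i => ->; have [j'|] := unliftP ord_max j => ->;
  have [k'|] := unliftP ord_max k => ->; have [l'|] := unliftP ord_max l => ->;
  rewrite /= ?inE ?(inj_eq (@lift_inj _ _)) ?lf ?fl ?eqxx ?andbF ?orbF //= => u.
  - by apply: vpM.1; move: u; rewrite /= !inE ?orbF.
  - apply: fixT; move: u; rewrite andbT.
    by case: (i' == j'); case: (i' == k'); case: (j' == k').
  - apply: fixT; move: u; rewrite andbT.
    by case: (i' == j'); case: (i' == l'); case: (j' == l').
  - apply/esym/fixT; move: u; rewrite andbT ![_ == i']eq_sym.
    by case: (i' == k'); case: (i' == l'); case: (k' == l').
  - apply/esym/fixT; move: u; rewrite andbT ![_ == j']eq_sym.
    by case: (j' == k'); case: (j' == l'); case: (k' == l').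
rewrite /add_strand.
have [i'|] := unliftP ord_max i => ->; have [j'|] := unliftP ord_max j => ->;
have [k'|] := unliftP ord_max k => ->;
rewrite /= ?inE ?(inj_eq (@lift_inj _ _)) ?lf ?fl ?eqxx ?andbF ?orbF //= => u.
- by apply: vpM.2; move: u; rewrite /= !inE ?orbF.
- have /third[k0 /exM[_ e _ _ _]] : i' != j' by move: u; rewrite andbT.
  by rewrite -e mulgA.
- have /third[j0 /exM[e _ _ _ _]] : k' != i' by move: u; rewrite andbT eq_sym.
  by rewrite -mulgA e.
- have /third[i0 /exM[_ _ e _ _]] : k' != j' by move: u; rewrite andbT eq_sym.
  apply: (mulgI (T (j', true))^-1); rewrite -[X in _ = _ * X]mulgA mulKg.
  by rewrite 2!mulgA -e -mulgA mulgVK.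
Qed.

End Extension.

Section Wreath.
Variables (S : Type) (F : groupType).
Implicit Types (c : F -> bij S) (h : bij F).

Definition wreath_fun c h (z : S * F) : S * F := (c z.2 z.1, h z.2).
Definition wreath_inv c h (z : S * F) : S * F :=
  let u := bij_inv h z.2 in (bij_inv (c u) z.1, u).

Fact wreath_funK c h : cancel (wreath_fun c h) (wreath_inv c h).
Proof. by move=> [m u]; rewrite /wreath_inv /= !bij_funK. Qed.
Fact wreath_invK c h : cancel (wreath_inv c h) (wreath_fun c h).
Proof. by move=> [m u]; rewrite /wreath_fun /= !bij_invK. Qed.

Definition wreath c h : bij (S * F) := Bij (wreath_funK c h) (wreath_invK c h).

Lemma wreathM c h c' h' :
  wreath c h * wreath c' h' = wreath (fun u => c (h' u) * c' u) (h * h').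
Proof. exact: bijP. Qed.

Lemma eq_wreath c h c' h' : c =1 c' -> h = h' -> wreath c h = wreath c' h'.
Proof. by move=> /funext -> ->. Qed.

Variable delta : F -> bij S.

(* [delta] cancels in every product L R, so that cables act on the first component
   independently of the second one. *)
Definition wreathR mu h := wreath (fun u => delta (h u) * mu) h.
Definition wreathL mu h := wreath (fun u => mu / delta u) h.

Lemma wreathLRL m1 h1 m2 h2 m3 h3 :
  wreathL m1 h1 * wreathR m2 h2 * wreathL m3 h3 = wreathL (m1 * m2 * m3) (h1 * h2 * h3).
Proof. by rewrite !wreathM; apply: eq_wreath => // u; rewrite !mulgA mulgVK. Qed.

Lemma wreathRLR m1 h1 m2 h2 m3 h3 :
  wreathR m1 h1 * wreathL m2 h2 * wreathR m3 h3 = wreathR (m1 * m2 * m3) (h1 * h2 * h3).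
Proof.
by rewrite !wreathM; apply: eq_wreath => // u; rewrite -!mulgA mulKg.
Qed.

Lemma wreathLR m1 h1 m2 h2 :
  wreathL m1 h1 * wreathR m2 h2 = wreath (fun=> m1 * m2) (h1 * h2).
Proof. by rewrite wreathM; apply: eq_wreath => // u; rewrite mulgA mulgVK. Qed.

Variables phi phi' : {multiplicative F -> bij S}.
Hypothesis deltaE : forall u, delta u = phi u / phi' u.

Definition wreathT t := wreath (fun=> phi t) (translation t).

Fact wreathTM : {morph wreathT : t u / t * u}.
Proof.
by move=> t u; rewrite wreathM; apply: eq_wreath => [z|]; rewrite gmulfM.
Qed.
HB.instance Definition _ := isMultiplicative.Build F (bij (S * F)) wreathT wreathTM.

Lemma wreathL_exchange mu h t : {morph h : u z / u * z} ->
  mu * phi' t = phi (h t) * mu -> wreathL mu h * wreathT t = wreathT (h t) * wreathL mu h.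
Proof.
move=> hM e; rewrite !wreathM; apply: eq_wreath => [u|].
  by rewrite /= !deltaE !gmulfM !invgF invgM !mulgA mulgVK e.
by apply: bijP => u; rewrite /= hM.
Qed.

Lemma wreathR_exchange mu h t : {morph h : u z / u * z} ->
  mu * phi t = phi' (h t) * mu -> wreathR mu h * wreathT t = wreathT (h t) * wreathR mu h.
Proof.
move=> hM e; rewrite !wreathM; apply: eq_wreath => [u|].
  by rewrite /= !deltaE hM !gmulfM invgM -[_ * mu * _]mulgA e !mulgA mulgVK.
by apply: bijP => u; rewrite /= hM.
Qed.

End Wreath.

Section LoopFamily.
Variables (S : Type) (x y x' y' j k l l' p f a D d m : bij S).
Hypothesis loops : cube_loops x y x' y' j k l l' p f.
Hypothesis aE : a = p^-1 * j * x.
Hypothesis DE : D = l' * j * x / x'.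
Hypothesis dE : d = p^-1 * D.
Hypothesis mE : m = l ^ k.

Notation F := (free_group ('I_3 * bool)).
Let loop : 'I_3 * bool -> bij S := strand_loop x y x' k f a D m.
Let loop' : 'I_3 * bool -> bij S := strand_loop' x y x' k l f a D m.
Let phi := free_lift loop.
Let phi' := free_lift loop'.
Let delta u : bij S := phi u / phi' u.

Definition cyclic_pair (u v : 'I_3) : bool := val v == (val u).+1 %% 3.

Definition pair_loop (u v : 'I_3) : bij S :=
  match val u, val v with
  | 1, 0 => p | 0, 2 => f^-1 | 2, 0 => d | 1, 2 => f | _, _ => 1
  end.

Definition pair_wreath (u v : 'I_3) : bij (S * F) :=
  if cyclic_pair u v then wreathR delta (pair_loop u v) (strand_bij u v)
  else wreathL delta (pair_loop u v) (strand_bij u v).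

Let T (s : 'I_3 * bool) : bij (S * F) := wreathT phi (free_gen s).

Let s1 : 'I_3 := @Ordinal 3 0 isT.
Let s2 : 'I_3 := @Ordinal 3 1 isT.
Let s3 : 'I_3 := @Ordinal 3 2 isT.

Let sE (z : 'I_3) : [|| z == s1, z == s2 | z == s3].
Proof. by case: z => [[|[|[|z]]] //= lz]; rewrite -!val_eqE. Qed.

Let pair_loop_exchange u v w : uniq [:: u; v; w] ->
  if cyclic_pair u v then exchange (pair_loop u v) loop loop' u v w
  else exchange (pair_loop u v) loop' loop u v w.
Proof.
have e12 := exchange12 loops aE DE mE erefl erefl.
have e21 := exchange21 loops aE DE mE erefl erefl.
have e13 := exchange13 loops aE DE mE erefl erefl.
have e31 := exchange31 loops aE DE dE mE erefl erefl.
have e23 := exchange23 loops aE DE mE erefl erefl.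
have e32 := exchange32 D loops aE mE erefl.
by case/or3P: (sE u) => /eqP ->; case/or3P: (sE v) => /eqP ->;
   case/or3P: (sE w) => /eqP ->.
Qed.

Let T_mul z t : T z * T t = wreathT phi (free_gen z * free_gen t).
Proof. by rewrite gmulfM. Qed.

Lemma pair_wreath_exchange u v w : uniq [:: u; v; w] ->
  exchange (pair_wreath u v) T T u v w.
Proof.
move=> uvw; have := pair_loop_exchange uvw; rewrite /pair_wreath.
move: uvw; rewrite /= !inE negb_or andbT => /andP[/andP[uv uw] vw].
have [] := @strand_bij_exchange _ u v w uv; rewrite 1?eq_sym //.
set h := strand_bij u v => h1 h2 h3 h4 h5.
have hM : {morph h : z t / z * t} by exact: free_liftM.
have TV z t : T z / T t = wreathT phi (free_gen z / free_gen t) by rewrite homF.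
have VT z t : (T z)^-1 * T t = wreathT phi ((free_gen z)^-1 * free_gen t).
  by rewrite gmulfM homV.
have G (b : bool) mu :
    (if b then exchange mu loop loop' u v w else exchange mu loop' loop u v w) ->
    exchange (if b then wreathR delta mu h else wreathL delta mu h) T T u v w.
  have phiE s : phi (free_gen s) = loop s by exact: free_lift_gen.
  have phi'E s : phi' (free_gen s) = loop' s by exact: free_lift_gen.
  have phiM : {morph phi : z t / z * t} by exact: free_liftM.
  have phi'M : {morph phi' : z t / z * t} by exact: free_liftM.
  have phiV : {morph phi : z / z^-1} by exact: homV.
  have phi'V : {morph phi' : z / z^-1} by exact: homV.
  have deltaE z : delta z = phi z / phi' z by [].
  case: b => [] [e1 e2 e3 e4 e5].
    have K t t' : h t = t' -> mu * phi t = phi' t' * mu ->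
        wreathR delta mu h * wreathT phi t = wreathT phi t' * wreathR delta mu h.
      by move=> <-; exact: wreathR_exchange.
    split; rewrite ?T_mul ?TV ?VT; (apply: K; first by []).
    - by rewrite phiM phi'M !phiE !phi'E.
    - by rewrite phiM phi'M !phiE !phi'E.
    - by rewrite phiM phi'M phiV phi'V !phiE !phi'E.
    - by rewrite phiE phi'E.
    - by rewrite phiE phi'E.
  have K t t' : h t = t' -> mu * phi' t = phi t' * mu ->
      wreathL delta mu h * wreathT phi t = wreathT phi t' * wreathL delta mu h.
    by move=> <-; exact: wreathL_exchange.
  split; rewrite ?T_mul ?TV ?VT; (apply: K; first by []).
  - by rewrite phiM phi'M !phiE !phi'E.
  - by rewrite phiM phi'M !phiE !phi'E.
  - by rewrite phiM phi'M phiV phi'V !phiE !phi'E.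
  - by rewrite phiE phi'E.
  - by rewrite phiE phi'E.
exact: G.
Qed.

Lemma pair_wreath_vp_family : vp_family pair_wreath.
Proof.
split.
  move=> u v w z uvwz; move/card_uniqP in uvwz.
  by have := max_card [in [:: u; v; w; z]]; rewrite uvwz card_ord.
move=> u v w uvw; have [pD fD] := diagonal_loop_commute loops DE erefl erefl.
have pairE : pair_loop w u * pair_loop w v * pair_loop u v =
             pair_loop u v * pair_loop w v * pair_loop w u.
  have Epd : p * d = D by rewrite dE mulVKg.
  have Edp : d * p = D by rewrite dE -mulgA -pD mulKg.
  move: uvw; case/or3P: (sE u) => /eqP ->; case/or3P: (sE v) => /eqP ->;
  case/or3P: (sE w) => /eqP -> // _; rewrite /pair_loop /= ?mulg1 ?mul1g;
  rewrite ?mulgVK ?mulgV ?mulVg ?mul1g ?Epd ?Edp //.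
  - by rewrite mulgK.
  - by rewrite -mulgA Epd.
have cyc : (cyclic_pair w u = cyclic_pair u v) /\ (cyclic_pair w v = ~~ cyclic_pair u v).
  by move: uvw; case/or3P: (sE u) => /eqP ->; case/or3P: (sE v) => /eqP ->;
     case/or3P: (sE w) => /eqP ->.
rewrite /pair_wreath cyc.1 cyc.2; case: (cyclic_pair u v) => /=.
  by rewrite !wreathRLR pairE strand_bij_yb.
by rewrite !wreathLRL pairE strand_bij_yb.
Qed.

Definition cable_loop (g : T3_gen) : bij S :=
  match g with
  | A13 => x | A22 => a | A31 => x' | B13 => y | B22 => p^-1 * y * l | B31 => y'
  end.

Lemma cable_loop_hom : exists e : {multiplicative VP 4 -> bij (S * F)},
  forall g, exists h, e (T3_cable (@lambda 4) g) = wreath (fun=> cable_loop g) h.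
Proof.
pose L := add_strand pair_wreath T.
have [e eE] := VP_lift_ex (add_strand_vp_family pair_wreath_vp_family pair_wreath_exchange).
exists e => g.
have -> : e (T3_cable (@lambda 4) g) = T3_cable L g.
  by case: g; rewrite /= !gmulfM /= !eE.
have LM u v : L (lift ord_max u) (lift ord_max v) = pair_wreath u v.
  by rewrite /L /add_strand !liftK.
have LX u : L (lift ord_max u) ord_max = T (u, false).
  by rewrite /L /add_strand liftK unlift_none.
have LY u : L ord_max (lift ord_max u) = T (u, true).
  by rewrite /L /add_strand liftK unlift_none.
have t1 : @Ordinal 4 0 isT = lift ord_max s1 by exact: val_inj.
have t2 : @Ordinal 4 1 isT = lift ord_max s2 by exact: val_inj.
have t3 : @Ordinal 4 2 isT = lift ord_max s3 by exact: val_inj.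
have t4 : @Ordinal 4 3 isT = ord_max by exact: val_inj.
have TE s : T s = wreath (fun=> loop s) (translation (free_gen s)).
  by apply: eq_wreath => // _; exact: free_lift_gen.
have [[eA31 eA22 eA13] [eB31 eB22 eB13]] := strand_loop_cables a loops DE dE mE.
have M12 : pair_wreath s1 s2 = wreathR delta 1 (strand_bij s1 s2) by [].
have M21 : pair_wreath s2 s1 = wreathL delta p (strand_bij s2 s1) by [].
have M13 : pair_wreath s1 s3 = wreathL delta f^-1 (strand_bij s1 s3) by [].
have M31 : pair_wreath s3 s1 = wreathR delta d (strand_bij s3 s1) by [].
have M23 : pair_wreath s2 s3 = wreathR delta f (strand_bij s2 s3) by [].
have M32 : pair_wreath s3 s2 = wreathL delta 1 (strand_bij s3 s2) by [].
case: g; rewrite /= t1 t2 t3 t4 !(LM, LX, LY).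
- by rewrite !TE !wreathM; eexists; apply: eq_wreath => // _; rewrite eA31.
- rewrite -mulgA M13 M23 wreathLR !TE !wreathM; eexists; apply: eq_wreath => // _.
  by rewrite mulVg mulg1 eA22.
- rewrite -mulgA M13 M12 wreathLR !TE !wreathM; eexists; apply: eq_wreath => // _.
  by rewrite mulg1 eA13.
- by rewrite !TE !wreathM; eexists; apply: eq_wreath => // _; rewrite eB31.
- rewrite M32 M31 wreathLR !TE !wreathM; eexists; apply: eq_wreath => // _.
  by rewrite mul1g eB22.
- by rewrite M21 M31 wreathLR !TE !wreathM; eexists; exact: eq_wreath.
Qed.

End LoopFamily.

(** * The equivariant map onto the presented group *)

Section SpineCube.
Variable G : groupType.

Definition spine_cube (x a x' y b y' p w : G) (s : cube_gen) : G :=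
  match s with
  | CX => x | CX' => x' | CY => y | CY' => y'
  | CJ => p * a / x | CK => w * a / x' | CL => b / y * p | CL' => b / y' * w
  end.

Variables x a x' y b y' p w : G.
Hypothesis spine : T3_spine x a x' y b y' p w.
Let h := spine_cube x a x' y b y' p w.

Lemma spine_cubeP : cube (h CX) (h CY) (h CX') (h CY') (h CJ) (h CK) (h CL) (h CL').
Proof.
case: spine => [[xa xx' ax'] [yb yy' by'] [pa pb px' py' pw] [wa wb wx wy] [h1 h2 h3 h4]].
rewrite /h /=; split; try (split; commute_tac).
rewrite !mulgVK !mulgA.
rewrite -[y * b / y]mulgA (commuteV (commute_sym yb)) mulVKg.
rewrite -[y' * b / y']mulgA (commuteV by') mulVKg.
by rewrite (commute_sym pb) (commute_sym wb) !invgM !mulgA !mulgK.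
Qed.

Lemma spine_cube_diagonal : h CJ * h CX / (h CK * h CX') = p / w.
Proof. by rewrite /h /= !mulgVK invgM mulgA mulgK. Qed.

Lemma spine_cube_conj s :
  h s ^ p = if p_moved s then h s ^ (h CJ * h CX / (h CK * h CX')) else h s.
Proof.
case: spine => [[xa xx' ax'] [yb yy' by'] [pa pb px' py' pw] [wa wb wx wy] _].
have -> : h CJ * h CX / (h CK * h CX') = w^-1 * p.
  by rewrite spine_cube_diagonal (commuteV pw).
have moved u : commute u w -> u ^ p = u ^ (w^-1 * p).
  by move=> uw; rewrite conjgM (conjg_id (commuteV uw)).
by case: s; (apply: moved || apply: conjg_id); rewrite /h /=; commute_tac.
Qed.

End SpineCube.

Lemma hom_twist (G H : groupType) (e : {multiplicative G -> H}) x a y b n :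
  e (twist x a y b n) = twist (e x) (e a) (e y) (e b) n.
Proof. by rewrite gmulfM !hom_expgz !gmulfM. Qed.

Section Automorphisms.
Notation P := (presented T3_rel).
Let g := pres_gen T3_rel.

Lemma T3_presented_commute :
  T3_commute (g A13) (g A22) (g A31) (g B13) (g B22) (g B31).
Proof. by apply/T3_relP => r Rr; rewrite -pres_proj_lift pres_proj_rel. Qed.

Lemma twist_aut_ex (X Y : T3_gen) (moved : T3_gen -> bool)
    (h := fun n s => if moved s then g s ^ twist (g X) (g A22) (g Y) (g B22) n else g s) :
  moved X -> moved Y -> moved A22 = false -> moved B22 = false ->
  (forall n, T3_commute (h n A13) (h n A22) (h n A31) (h n B13) (h n B22) (h n B31)) ->
  exists (e : {multiplicative P -> P}) (F : bij P),
    F =1 e /\ forall s, e (g s) = h 1%R s.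
Proof.
move=> mX mY mA mB hR.
have ex n : exists e : {multiplicative P -> P}, forall s, e (g s) = h n s.
  by apply: pres_lift_ex; apply/T3_relP.
have [e eE] := ex 1%R; have [e' e'E] := ex (-1)%R.
have K n m (u v : {multiplicative P -> P}) : (n + m = 0)%R ->
    (forall s, u (g s) = h n s) -> (forall s, v (g s) = h m s) -> cancel v u.
  move=> nm uE vE; apply: (@presented_hom_eq _ _ _ (u \o v) idfun) => s /=.
  rewrite vE /h; case: ifP => ms; last by rewrite uE /h ms.
  rewrite homJ hom_twist !uE /h ms mX mY mA mB conj_twist_twist nm.
  by rewrite /twist mulg1 conjg1.
by exists e, (Bij (K (-1)%R 1%R e' e erefl e'E eE) (K 1%R (-1)%R e e' erefl eE e'E)).
Qed.

Lemma T3_spine_ex (t := fun s => translation (g s)) :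
  exists p w : bij P, p 1 = 1 /\
    T3_spine (t A13) (t A22) (t A31) (t B13) (t B22) (t B31) p w.
Proof.
have [e [E [Ee eE]]] := @twist_aut_ex A13 B13
  (fun s => match s with A13 | B13 => true | _ => false end) isT isT erefl erefl
  (fun n => T3_commute_twist n T3_presented_commute).
have [e' [E' [Ee' e'E]]] := @twist_aut_ex A31 B31
  (fun s => match s with A31 | B31 => true | _ => false end) isT isT erefl erefl
  (fun n => T3_commute_sym (T3_commute_twist n (T3_commute_sym T3_presented_commute))).
exists E^-1, E'^-1; split.
  by apply: (can_inj (bij_funK E)); rewrite bij_invK Ee hom1.
have fixed (T : {multiplicative P -> P}) (K : bij P) s :
    K =1 T -> T (g s) = g s -> commute K^-1 (t s).
  move=> KT Ts; apply/commute_sym/conjg_idP.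
  by rewrite (conj_translation KT) Ts.
have [[c1 c2 c3] [d1 d2 d3]] := T3_presented_commute 0%R 0%R.
rewrite /twist !mulg1 !conjg1 in c1 c2 c3 d1 d2 d3.
have tc s s' : commute (g s) (g s') -> commute (t s) (t s').
  by move=> ss'; rewrite /commute /t -2!translationM ss'.
have pw : commute E^-1 E'^-1.
  apply/commuteV/commute_sym/commuteV; apply: bijP => z.
  rewrite /= !Ee !Ee'; move: z.
  apply: (@presented_hom_eq _ _ _ (e' \o e) (e \o e')).
  by case; rewrite /= ?eE ?e'E ?(homJ, hom_twist) ?eE ?e'E.
have cj (T : {multiplicative P -> P}) (K : bij P) s X Y : K =1 T ->
    T (g s) = g s ^ twist (g X) (g A22) (g Y) (g B22) 1%R ->
    t s ^ K^-1 = t s ^ twist (t X) (t A22) (t Y) (t B22) 1%R.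
  by move=> KT Ts; rewrite (conj_translation KT) Ts homJ hom_twist.
have pt s : e (g s) = g s -> commute E^-1 (t s) by exact: fixed Ee.
have wt s : e' (g s) = g s -> commute E'^-1 (t s) by exact: fixed Ee'.
have [h1 h2] := (twist_conjP (tc _ _ (commute_sym c3)) (tc _ _ (commute_sym d3))
  (pt B22 (eE B22))).2
  (conj (cj _ _ _ A13 B13 Ee (eE A13)) (cj _ _ _ A13 B13 Ee (eE B13))).
have [h3 h4] := (twist_conjP (tc _ _ c1) (tc _ _ d1) (wt B22 (e'E B22))).2
  (conj (cj _ _ _ A31 B31 Ee' (e'E A31)) (cj _ _ _ A31 B31 Ee' (e'E B31))).
split; split=> //; first [exact: tc | exact/tc/commute_sym | exact/pt/eE | exact/wt/e'E].
Qed.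

End Automorphisms.

Lemma T3_elt_cable g : T3_elt g = T3_cable (@lambda 4) g.
Proof.
have inordE i (li : i < 4) : inord i = Ordinal li by apply: val_inj; rewrite /= inordK.
have [e1 e2] := (inordE 0 isT, inordE 1%N isT); have [e3 e4] := (inordE 2 isT, inordE 3 isT).
by case: g; rewrite /= /lam /= ?e1 ?e2 ?e3 ?e4.
Qed.

Lemma T3_action_ex : exists (S : Type) (z0 : S) (Theta : S -> presented T3_rel)
    (e : {multiplicative VP 4 -> bij S}),
  forall g z, Theta (e (T3_cable (@lambda 4) g) z) = pres_gen T3_rel g * Theta z.
Proof.
pose g := pres_gen T3_rel; pose c := pres_gen [set` cube_relators].
have [p [w [p1 spine]]] := T3_spine_ex.
have [theta thetaE] := pres_lift_ex ((cube_relP _).2 (spine_cubeP spine)).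
have [u [P [F [Pu uE loops]]]] := cube_loops_ex.
have theta_u : forall m, theta (u m) = theta m ^ p.
  pose conjp t : bij (presented T3_rel) := t ^ p.
  have conjpM : {morph conjp : t t' / t * t'} by move=> t t'; exact: conjMg.
  pose conjp_hom := HB.pack_for {multiplicative _ -> _} conjp
    (isMultiplicative.Build _ _ conjp conjpM).
  apply: (@presented_hom_eq _ _ _ (theta \o u) (conjp_hom \o theta)) => s /=.
  rewrite /conjp thetaE (spine_cube_conj spine) uE.
  by case: ifP => _; rewrite ?homJ ?homF ?gmulfM /= !thetaE.
pose Theta m := theta m 1.
have ThetaP m : Theta ((P^-1 : bij _) m) = (p^-1 : bij _) (Theta m).
  by rewrite Pu /Theta theta_u /conjg /= p1.
have ThetaM s m : Theta (c s * m) = theta (c s) (Theta m) by rewrite /Theta gmulfM.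
have [e eE] := cable_loop_hom loops erefl erefl erefl erefl.
exists (cube_group * free_group ('I_3 * bool))%type, (1, 1), (fun z => Theta z.1), e.
move=> s [m z]; have [h ->] := eE s.
have thetaX q : theta (c q) = spine_cube _ _ _ _ _ _ p w q := thetaE q.
case: s => /=.
- by rewrite (ThetaM CX') thetaX.
- rewrite ThetaP (ThetaM CJ) (ThetaM CX) !thetaX /=.
  by rewrite bij_funK mulKg.
- by rewrite (ThetaM CX) thetaX.
- by rewrite (ThetaM CY') thetaX.
- rewrite ThetaP (ThetaM CY) (ThetaM CL) !thetaX.
  case: spine => [_ [yb _ _] [_ pb _ _ _] _ _].
  have E : p^-1 * (translation (g B13) * (translation (g B22) / translation (g B13) * p)) =
      translation (g B22) :> bij _.
    by rewrite (commuteV (commute_sym yb)) -!mulgA mulVKg -pb mulKg.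
  exact: (congr1 (fun K : bij _ => K (Theta m)) E).
- by rewrite (ThetaM CY) thetaX.
Qed.

Theorem theorem5p14 :
  exists f : {multiplicative presented T3_rel -> VP 4},
    [/\ forall x : T3_gen, f (pres_gen T3_rel x) = T3_elt x,
        injective f
      & range f = T3].
Proof.
have [|f fE] := @pres_lift_ex _ T3_rel _ T3_elt.
  apply/T3_relP; rewrite !T3_elt_cable.
  exact: T3_spine_commute (cable_spine (lambda_vp_family 4)).
exists f; split=> //.
  have [S [z0 [Theta [e eE]]]] := T3_action_ex.
  have key u : forall z, Theta (e (f u) z) = u * Theta z.
    elim/presented_ind: u => [|g u IH|g u IH] z; first by rewrite !hom1 mul1g.
    - by rewrite !gmulfM fE T3_elt_cable /= eE IH mulgA.
    - apply: (mulgI (pres_gen T3_rel g)); rewrite -mulgA mulVKg -IH -eE.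
      by rewrite !gmulfM !homV fE T3_elt_cable /= bij_invK.
  move=> u v uv; apply: (mulIg (Theta z0)).
  by rewrite -!key uv.
apply/seteqP; split=> [_ [u _ <-]|v].
  move=> H HG HS; have gH g : f (pres_gen T3_rel g) \in H by rewrite fE; apply: HS; exists g.
  elim/presented_ind: u => [|g u IH|g u IH]; first by rewrite hom1; exact: HG.1.
  - by rewrite gmulfM; apply: group_closedM.
  - by rewrite gmulfM homV; apply: group_closedM => //; apply: group_closedV.
move=> /(_ [pred v | `[< range f v >]]) gen.
apply/asboolP; apply: gen => [|_ [g _ <-]]; last first.
  by apply/asboolP; exists (pres_gen T3_rel g); rewrite ?fE.
split=> [|_ _ /asboolP[u _ <-] /asboolP[v' _ <-]]; apply/asboolP.
  by exists 1; rewrite ?hom1.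
by exists (u / v'); rewrite ?homF.
Qed.
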